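(* Let $f:\mathbb{R}^n\to\mathbb{R}$ and the stochastic estimators $G_\delta$, $H$ satisfy Assumption A (stated in the context) with constants $f_{\mathrm{low}},L,L_F,\sigma$. Define $$M_{\mathrm{pm}}:=54\Big(f(x^0)-f_{\mathrm{low}}+\sigma^3L_F^{-2}+L_F^{3/2}\sigma^3+1\Big).$$ For a positive integer $K$, let $\{x^k\}$ be all iterates generated by the SCRN method with Polyak momentum (described in the context) started at $x^0\in\mathbb{R}^n$ with input parameters $$\eta_k=\frac{1}{9K^{2/7}},\qquad \theta_k=\frac{7L_F}{3K^{2/7}},\qquad \delta_k=\frac{1}{9K^{4/7}}\qquad\forall k\ge 0,$$ and let $\iota_K$ be uniformly drawn from $\{1,\ldots,K\}$. Then, for any $\epsilon_g,\epsilon_H\in(0,1)$, $x^{\iota_K}$ is an $(\epsilon_g,\epsilon_H)$-stochastic second-order stationary point of $\min_{x\in\mathbb{R}^n}f(x)$, that is, $$\mathbb{E}[\|\nabla f(x^{\iota_K})\|^{3/2}]\le\epsilon_g^{3/2}\quad\text{and}\quad \mathbb{E}[\lambda_{\min}(\nabla^2f(x^{\iota_K}))^3]\ge-\epsilon_H^3,$$ for all $K$ satisfying $$K\ge\max\bigg\{\Big(\frac{(3M_{\mathrm{pm}})^{2/3}}{\epsilon_g}\Big)^{7/4},\Big(\frac{(108M_{\mathrm{pm}})^{1/3}}{\epsilon_H}\Big)^{7},\Big(\frac{2L}{9}\Big)^{7/2},\Big(\frac{7L_F}{3}\Big)^{7/2},1\bigg\}.$$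
   Context: Notation: $\|\cdot\|$ is the Euclidean norm for vectors and the spectral norm for matrices; $\|\cdot\|_F$ is the Frobenius norm; $\lambda_{\min}$ is the minimum eigenvalue. Throughout, $f:\mathbb{R}^n\to\mathbb{R}$ is twice continuously differentiable and $\min_{x\in\mathbb{R}^n}f(x)$ has at least one optimal solution. Assumption A. (a) There is a finite $f_{\mathrm{low}}$ with $f(x)\ge f_{\mathrm{low}}$ for all $x\in\mathbb{R}^n$. (b) There exist $L>0$ and $L_F>0$ with $\|\nabla^2f(y)-\nabla^2f(x)\|\le L\|y-x\|$ and $\|\nabla^2f(y)-\nabla^2f(x)\|_F\le L_F\|y-x\|$ for all $x,y\in\mathbb{R}^n$. (c) For any $\delta\in(0,1)$ there is a stochastic gradient estimator $G_\delta:\mathbb{R}^n\times\mathcal{Z}\to\mathbb{R}^n$ with $\mathbb{E}_\zeta[\|G_\delta(x;\zeta)-\nabla f(x)\|^{3/2}]\le\delta^{3/2}$ for all $x\in\mathbb{R}^n$. (d) There is a stochastic Hessian estimator $H:\mathbb{R}^n\times\Xi\to\mathbb{R}^{n\times n}$ and $\sigma>0$ with $\mathbb{E}_\xi[H(x;\xi)]=\nabla^2f(x)$ and $\mathbb{E}_\xi[\|H(x;\xi)-\nabla^2f(x)\|_F^3]\le\sigma^3$ for all $x\in\mathbb{R}^n$. SCRN method with Polyak momentum. Input: starting point $x^0\in\mathbb{R}^n$, regularization parameters $\{\eta_k\}\subset(0,\infty)$, error parameters $\{\delta_k\}\subset(0,1)$, momentum parameters $\{\theta_k\}\subset(0,1)$.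 Initialize $M_{-1}=0$, $\theta_{-1}=1$. For $k=0,1,2,\ldots$: draw fresh samples $\zeta^k$, $\xi^k$ (independent of all earlier randomness) and set $$g^k=G_{\delta_k}(x^k;\zeta^k),\qquad M_k=(1-\theta_{k-1})M_{k-1}+\theta_{k-1}H(x^k;\xi^k),$$ and choose $$x^{k+1}\in\mathop{\mathrm{Arg\,min}}_{x\in\mathbb{R}^n}\Big\{(g^k)^T(x-x^k)+\tfrac12(x-x^k)^TM_k(x-x^k)+\tfrac{1}{6\eta_k}\|x-x^k\|^3\Big\}.$$ The index $\iota_K$ is drawn independently of the algorithm's randomness, and $\mathbb{E}$ is expectation over all randomness (samples and $\iota_K$). *)

(* Defs.v *)
From HB Require Import structures.
From mathcomp Require Import all_boot all_order all_algebra.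
From mathcomp Require Import all_classical all_reals all_analysis.

Set Implicit Arguments.
Unset Strict Implicit.
Unset Printing Implicit Defensive.

Import Order.TTheory GRing.Theory Num.Theory.
Import numFieldNormedType.Exports.

Local Open Scope classical_set_scope.
Local Open Scope ring_scope.

(* Points of R^n are row vectors. The library's norm `|_| on matrices is the
   max norm: it is used only through the topology it induces, and the norms
   of the statement are the ones defined here. *)

(* On row and column vectors, fnorm is the Euclidean norm. *)
Definition fnorm (R : realType) (m n : nat) (A : 'M[R]_(m, n)) : R :=
  Num.sqrt (\sum_(i < m) \sum_(j < n) A i j ^+ 2).

Definition spectral_norm (R : realType) (n : nat) (A : 'M[R]_n) : R :=
  sup [set fnorm (A *m v) | v in [set v : 'cV[R]_n | fnorm v <= 1]].

(* Used only for symmetric A and 0 < n: the set of eigenvalues is then finite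
   and nonempty, so that the infimum is a minimum. *)
Definition lambda_min (R : realType) (n : nat) (A : 'M[R]_n) : R :=
  inf [set a : R | eigenvalue A a].

Definition grad (R : realType) (n : nat) (f : 'rV[R]_n -> R) (x : 'rV[R]_n) :
    'rV[R]_n :=
  \row_(i < n) 'D_(delta_mx 0 i) f x.

Definition hess (R : realType) (n : nat) (f : 'rV[R]_n -> R) (x : 'rV[R]_n) :
    'M[R]_n :=
  \matrix_(i < n, j < n) 'D_(delta_mx 0 i) ('D_(delta_mx 0 j) f) x.

Definition twice_continuously_differentiable (R : realType) (n : nat)
    (f : 'rV[R]_n -> R) : Prop :=
  [/\ forall x, differentiable f x,
      forall x, differentiable (grad f) x
    & continuous (hess f)].

(* T with its Borel sigma-algebra. *)
Notation borel T := (g_sigma_algebraType (@open T)).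

Record assumptionA (R : realType) (n : nat) (f : 'rV[R]_n -> R)
    (dZ dXi : measure_display)
    (Z : measurableType dZ) (Xi : measurableType dXi)
    (PZ : probability Z R) (PXi : probability Xi R)
    (G : R -> 'rV[R]_n -> Z -> 'rV[R]_n) (H : 'rV[R]_n -> Xi -> 'M[R]_n)
    (flow L LF sigma : R) : Prop := AssumptionA {
  f_lower_bound : forall x, flow <= f x ;
  L_gt0 : 0 < L ;
  LF_gt0 : 0 < LF ;
  hess_lipschitz : forall x y,
    spectral_norm (hess f y - hess f x) <= L * fnorm (y - x) ;
  hess_lipschitz_F : forall x y,
    fnorm (hess f y - hess f x) <= LF * fnorm (y - x) ;
  G_measurable : forall delta : R, 0 < delta < 1 ->
    measurable_fun [set: (borel 'rV[R]_n * Z)%type]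
      ((fun p => G delta p.1 p.2)
         : (borel 'rV[R]_n * Z)%type -> borel 'rV[R]_n) ;
  G_error : forall delta : R, 0 < delta < 1 -> forall x,
    ('E_PZ[(fun z => fnorm (G delta x z - grad f x) `^ (3 / 2))%R]
       <= (delta `^ (3 / 2))%R%:E)%E ;
  H_measurable :
    measurable_fun [set: (borel 'rV[R]_n * Xi)%type]
      ((fun p => H p.1 p.2)
         : (borel 'rV[R]_n * Xi)%type -> borel 'M[R]_n) ;
  sigma_gt0 : 0 < sigma ;
  H_unbiased : forall x i j,
    ('E_PXi[fun s => H x s i j] = (hess f x i j)%:E)%E ;
  H_error : forall x,
    ('E_PXi[(fun s => fnorm (H x s - hess f x) ^+ 3)%R]
       <= (sigma ^+ 3)%R%:E)%E }.

(* prev_theta theta k is theta_{k-1}, with theta_{-1} = 1. *)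
Definition prev_theta (R : realType) (theta : nat -> R) (k : nat) : R :=
  if k is j.+1 then theta j else 1.

(* prev_momentum H theta x s k is M_{k-1}, with M_{-1} = 0, along the iterates
   x and the Hessian samples s. *)
Fixpoint prev_momentum (R : realType) (n : nat) (Xi : Type)
    (H : 'rV[R]_n -> Xi -> 'M[R]_n) (theta : nat -> R)
    (x : nat -> 'rV[R]_n) (s : nat -> Xi) (k : nat) : 'M[R]_n :=
  if k is j.+1 then
    (1 - prev_theta theta j) *: prev_momentum H theta x s j
      + prev_theta theta j *: H (x j) (s j)
  else 0.

Definition momentum (R : realType) (n : nat) (Xi : Type)
    (H : 'rV[R]_n -> Xi -> 'M[R]_n) (theta : nat -> R)
    (x : nat -> 'rV[R]_n) (s : nat -> Xi) (k : nat) : 'M[R]_n :=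
  prev_momentum H theta x s k.+1.

Definition cubic_model (R : realType) (n : nat) (g : 'rV[R]_n) (M : 'M[R]_n)
    (eta : R) (s : 'rV[R]_n) : R :=
  (g *m s^T) 0 0 + 2^-1 * (s *m M *m s^T) 0 0 + (6 * eta)^-1 * fnorm s ^+ 3.

Definition sigma_of (d : measure_display) (T : Type) (T' : measurableType d)
    (X : T -> T') : set_system T :=
  preimage_set_system [set: T] X measurable.

Definition independent (d : measure_display) (T : measurableType d)
    (R : realType) (P : probability T R) (F1 F2 : set_system T) : Prop :=
  forall A B, F1 A -> F2 B -> P (A `&` B) = (P A * P B)%E.

(* The sigma-algebra of the randomness realized before the k-th samples are
   drawn. Besides the previous samples, it contains the iterates up to x^k, as
   a random choice among several minimizers is allowed. *)
Definition past (R : realType) (n : nat) (T : Type)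
    (dZ dXi : measure_display)
    (Z : measurableType dZ) (Xi : measurableType dXi)
    (zeta : nat -> T -> Z) (xi : nat -> T -> Xi) (x : nat -> T -> 'rV[R]_n)
    (k : nat) : set_system T :=
  <<s (\bigcup_(j in [set j | (j < k)%N])
         (sigma_of (zeta j) `|` sigma_of (xi j)))
      `|` \bigcup_(j in [set j | (j <= k)%N])
            sigma_of (x j : T -> borel 'rV[R]_n) >>.

Definition algorithm_randomness (R : realType) (n : nat) (T : Type)
    (dZ dXi : measure_display)
    (Z : measurableType dZ) (Xi : measurableType dXi)
    (zeta : nat -> T -> Z) (xi : nat -> T -> Xi) (x : nat -> T -> 'rV[R]_n) :
    set_system T :=
  <<s \bigcup_k past zeta xi x k >>.

(* The samples zeta^k and xi^k of a same iteration may depend on each other. *)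
Record scrn_pm (R : realType) (n : nat)
    (dZ dXi : measure_display)
    (Z : measurableType dZ) (Xi : measurableType dXi)
    (PZ : probability Z R) (PXi : probability Xi R)
    (G : R -> 'rV[R]_n -> Z -> 'rV[R]_n) (H : 'rV[R]_n -> Xi -> 'M[R]_n)
    (x0 : 'rV[R]_n) (eta delta theta : nat -> R)
    (d : measure_display) (T : measurableType d) (P : probability T R)
    (zeta : nat -> {RV P >-> Z}) (xi : nat -> {RV P >-> Xi})
    (x : nat -> T -> 'rV[R]_n) : Prop := ScrnPm {
  zeta_law : forall k B, measurable B -> distribution P (zeta k) B = PZ B ;
  xi_law : forall k B, measurable B -> distribution P (xi k) B = PXi B ;
  fresh_samples : forall k,
    independent P (past zeta xi x k)
      (sigma_of (fun w => (zeta k w, xi k w))) ;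
  x_measurable : forall k,
    measurable_fun [set: T] (x k : T -> borel 'rV[R]_n) ;
  x_init : forall w, x 0%N w = x0 ;
  x_step : forall k w,
    let g := G (delta k) (x k w) (zeta k w) in
    let M := momentum H theta (x ^~ w) (fun j => xi j w) k in
    forall y, cubic_model g M (eta k) (x k.+1 w - x k w)
              <= cubic_model g M (eta k) (y - x k w) }.

Definition uniform_index (R : realType) (d : measure_display)
    (T : measurableType d) (P : probability T R) (K : nat)
    (idx : {RV P >-> nat}) : Prop :=
  forall k, (1 <= k <= K)%N -> distribution P idx [set k] = (K%:R^-1)%:E.

Definition stochastic_second_order_stationary (R : realType) (n : nat)
    (f : 'rV[R]_n -> R) (d : measure_display) (T : measurableType d)
    (P : probability T R) (epsg epsH : R) (y : T -> 'rV[R]_n) : Prop :=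
  ('E_P[(fun w => fnorm (grad f (y w)) `^ (3 / 2))%R]
     <= (epsg `^ (3 / 2))%R%:E)%E /\
  ((- epsH ^+ 3)%R%:E
     <= 'E_P[(fun w => lambda_min (hess f (y w)) ^+ 3)%R])%E.

Definition Mpm (R : realType) (f0 flow LF sigma : R) : R :=
  54 * (f0 - flow + sigma ^+ 3 * LF ^- 2 + LF `^ (3 / 2) * sigma ^+ 3 + 1).

(* Main.v *)
(* With q = K^(1/7), the regularization is eta = 1/(9 q^2), the momentum weight
   is theta = 7 LF / (3 q^2) <= 1 and delta = 1/(9 q^4). Write s_k for the norm
   of x^{k+1} - x^k and e_k for the Frobenius norm of M_k - hess f (x^k).

   A global minimizer of the cubic model is stationary and satisfies
   M_k + s_k / (2 eta) I >= 0. With Taylor's formula this gives, up to the error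
   of the gradient estimator, f(x^{k+1}) + (3/4) q^2 s_k^3
   <= f(x^k) + e_k^3 / (24 q^4), and bounds both the gradient and the least
   Hessian eigenvalue at x^{k+1} by s_k and e_k.

   The samples of step k+1 are independent of the past, so Fubini's theorem on
   the product of the past and the law of xi gives the contraction
   E e_{k+1}^3 <= (1 - 5 theta / 9) E e_k^3 + LF^3 theta^(-2) E s_k^3
   + 4 theta^(5/2) sigma^3.

   Hence E f(x^k) + E e_k^3 / (25 LF q^2) is a Lyapunov function up to O(1/K);
   summing over k bounds the averages of E s_k^3 and E e_k^3. *)
Require Import Defs.
From HB Require Import structures.
From mathcomp Require Import all_boot all_order all_algebra.
From mathcomp Require Import all_classical all_reals all_analysis.
From mathcomp Require Import measurable_realfun ring lra.
Import Order.TTheory GRing.Theory Num.Theory.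
Import numFieldNormedType.Exports.

Set Implicit Arguments.
Unset Strict Implicit.

Local Open Scope classical_set_scope.
Local Open Scope ring_scope.

(** * Frobenius and spectral norms *)

(** Square roots [l] of LF and [t] of theta, together with [q], make exponents integral: norms to
    the power 3/2 become cubes of square roots, LF^(3/2) is [l ^+ 3], theta^(5/2) is [t ^+ 5], and
    the estimates become polynomial. The cube of a norm is not polynomial; it is replaced by an
    upper expansion whose first-order term is linear in the perturbation. This yields stationarity
    of the cubic model without differentiating the norm, and in the noise estimate the linear term
    has mean zero. M_k may fail to be symmetric while the model sees only its symmetric part; the
    Hessian is proved symmetric, so that symmetrizing does not enlarge the error. Ties between
    minimizers may be broken at random, so x^k need not be a function of the samples: the past is
    kept as a sub-sigma-algebra of the sample space itself. Moments of f(x^k) and of the steps are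
    not finite by assumption; finiteness is obtained along the recursion before passing to real
    numbers. Functions not known to be measurable, such as lambda_min of the Hessian, are handled by
    one-sided bounds on integrals. *)

Definition dot (R : realType) (m n : nat) (A B : 'M[R]_(m, n)) : R :=
  \sum_i \sum_j A i j * B i j.

Section Frobenius.
Variable R : realType.
Section Rectangular.
Variables m n : nat.
Implicit Types A B C : 'M[R]_(m, n).

Lemma dotC A B : dot A B = dot B A.
Proof. by apply: eq_bigr => i _; apply: eq_bigr => j _; rewrite mulrC. Qed.

Lemma dotDl A B C : dot (A + B) C = dot A C + dot B C.
Proof.
rewrite /dot -big_split; apply: eq_bigr => i _ /=; rewrite -big_split.
by apply: eq_bigr => j _ /=; rewrite mxE mulrDl.
Qed.

Lemma dotZl a A B : dot (a *: A) B = a * dot A B.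
Proof.
rewrite /dot mulr_sumr; apply: eq_bigr => i _; rewrite mulr_sumr.
by apply: eq_bigr => j _; rewrite mxE mulrA.
Qed.

Lemma dotNl A B : dot (- A) B = - dot A B.
Proof. by rewrite -scaleN1r dotZl mulN1r. Qed.

Lemma dotDr A B C : dot C (A + B) = dot C A + dot C B.
Proof. by rewrite dotC dotDl !(dotC _ C). Qed.

Lemma dotZr a A B : dot A (a *: B) = a * dot A B.
Proof. by rewrite dotC dotZl dotC. Qed.

Lemma dotNr A B : dot A (- B) = - dot A B.
Proof. by rewrite dotC dotNl dotC. Qed.

Lemma dot_ge0 A : 0 <= dot A A.
Proof. by do 2!apply: sumr_ge0 => ? _; rewrite -expr2 sqr_ge0. Qed.

Lemma fnormE A : fnorm A = Num.sqrt (dot A A).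
Proof. by []. Qed.

Lemma fnorm_sqr A : fnorm A ^+ 2 = dot A A.
Proof. by rewrite fnormE sqr_sqrtr ?dot_ge0. Qed.

Lemma fnorm_ge0 A : 0 <= fnorm A.
Proof. exact: sqrtr_ge0. Qed.

Lemma fnorm_eq0 A : (fnorm A == 0) = (A == 0).
Proof.
rewrite fnormE sqrtr_eq0; apply/idP/eqP => [A0|->]; last first.
  by rewrite /dot !big1// => i _; rewrite big1// => j _; rewrite mxE mul0r.
apply/matrixP => i j; rewrite mxE; apply/eqP; rewrite -sqrf_eq0 eq_le sqr_ge0 andbT.
apply: le_trans A0; rewrite /dot (bigD1 i)//= (bigD1 j)//= -expr2 -addrA lerDl.
by rewrite addr_ge0// ?sumr_ge0// => k _; rewrite ?sumr_ge0// => *; rewrite -expr2 sqr_ge0.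
Qed.

Lemma fnorm0 : fnorm (0 : 'M[R]_(m, n)) = 0.
Proof. by apply/eqP; rewrite fnorm_eq0. Qed.

Lemma fnorm_gt0 A : (0 < fnorm A) = (A != 0).
Proof. by rewrite lt_def fnorm_eq0 fnorm_ge0 andbT. Qed.

Lemma fnormN A : fnorm (- A) = fnorm A.
Proof. by rewrite !fnormE dotNl dotNr opprK. Qed.

Lemma fnormZ a A : fnorm (a *: A) = `|a| * fnorm A.
Proof.
by rewrite !fnormE dotZl dotZr mulrA -expr2 sqrtrM ?sqr_ge0// sqrtr_sqr.
Qed.

Lemma dot_le A B : dot A B <= fnorm A * fnorm B.
Proof.
have [->|B0] := eqVneq B 0.
  by rewrite fnorm0 mulr0 /dot big1// => i _; rewrite big1// => j _; rewrite mxE mulr0.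
have bgt0 : 0 < fnorm B by rewrite fnorm_gt0.
have := dot_ge0 (fnorm B ^+ 2 *: A - dot A B *: B).
rewrite !(dotDl, dotDr, dotNl, dotNr, dotZl, dotZr) (dotC B A) -!fnorm_sqr.
set a := fnorm A; set b := fnorm B; set c := dot A B => h.
have a0 : 0 <= a by exact: fnorm_ge0.
have {}h : 0 <= b ^+ 2 * ((a * b) ^+ 2 - c ^+ 2) by lra.
rewrite pmulr_rge0 ?exprn_gt0// subr_ge0 in h.
have ab : 0 <= a * b by rewrite mulr_ge0// ltW.
by apply: le_trans (ler_norm _) _; rewrite -(ger0_norm ab) -ler_sqr ?nnegrE// !real_normK ?num_real.
Qed.

Lemma dot_ge A B : - (fnorm A * fnorm B) <= dot A B.
Proof. by rewrite lerNl -dotNl -(fnormN A) dot_le. Qed.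

Lemma fnormD_sqr A B : fnorm (A + B) ^+ 2 = fnorm A ^+ 2 + 2 * dot A B + fnorm B ^+ 2.
Proof. by rewrite !fnorm_sqr !(dotDl, dotDr) (dotC B A); lra. Qed.

Lemma fnormD A B : fnorm (A + B) <= fnorm A + fnorm B.
Proof.
rewrite -ler_sqr ?nnegrE ?addr_ge0 ?fnorm_ge0// fnormD_sqr.
by have := dot_le A B; lra.
Qed.

Lemma fnormB A B : fnorm (A - B) = fnorm (B - A).
Proof. by rewrite -fnormN opprB. Qed.

(* With b, c, N the norms of A, B, A + B, the claim is
   (N - b)^2 (N + b / 2) <= c^2 (3 b / 2 + c), where |N - b| <= c. *)
Lemma fnormD_cube A B :
  fnorm (A + B) ^+ 3 <= fnorm A ^+ 3 + 3 * fnorm A * dot A B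
                        + 3 * fnorm A * fnorm B ^+ 2 + fnorm B ^+ 3.
Proof.
have := fnormD_sqr A B; have := fnormD A B.
have := fnormD (A + B) (- B); rewrite addrK fnormN.
have := fnorm_ge0 (A + B); have := fnorm_ge0 A; have := fnorm_ge0 B.
move: (fnorm A) (fnorm B) (fnorm (A + B)) (dot A B) => b c N q c0 b0 N0 h1 h2 h3.
have -> : q = (N ^+ 2 - b ^+ 2 - c ^+ 2) / 2 by lra.
have hc : (N - b) ^+ 2 <= c ^+ 2.
  by rewrite -[leLHS]real_normK ?num_real// ler_sqr ?nnegrE// ler_norml; lra.
have h4 : (N - b) ^+ 2 * (N + b / 2) <= c ^+ 2 * (c + 3 / 2 * b).
  by apply: ler_pM => //; rewrite ?sqr_ge0//; lra.
lra.
Qed.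

Lemma fnorm_entry A i j : `|A i j| <= fnorm A.
Proof.
rewrite -ler_sqr ?nnegrE ?fnorm_ge0// real_normK ?num_real// fnorm_sqr.
rewrite /dot (bigD1 i)//= (bigD1 j)//= -expr2 -addrA lerDl.
by rewrite addr_ge0// ?sumr_ge0// => k _; rewrite ?sumr_ge0// => *; rewrite -expr2 sqr_ge0.
Qed.

End Rectangular.

Lemma fnorm_tr m n (A : 'M[R]_(m, n)) : fnorm A^T = fnorm A.
Proof.
rewrite !fnormE /dot exchange_big; congr Num.sqrt.
by apply: eq_bigr => i _; apply: eq_bigr => j _; rewrite mxE.
Qed.

Lemma mulmx_tr_dot n (u v : 'rV[R]_n) : (u *m v^T) 0 0 = dot u v.
Proof. by rewrite /dot big_ord1 mxE; apply: eq_bigr => i _; rewrite mxE. Qed.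

Lemma dot_mulmx_tr n (u v : 'rV[R]_n) (A : 'M[R]_n) :
  dot (u *m A) v = dot (v *m A^T) u.
Proof.
rewrite -!mulmx_tr_dot.
have -> : v *m A^T *m u^T = (u *m A *m v^T)^T by rewrite !trmx_mul trmxK mulmxA.
by rewrite [RHS]mxE.
Qed.

Lemma fnormM m n p (A : 'M[R]_(m, n)) (B : 'M[R]_(n, p)) :
  fnorm (A *m B) <= fnorm A * fnorm B.
Proof.
rewrite -ler_sqr ?nnegrE ?mulr_ge0 ?fnorm_ge0// exprMn !fnorm_sqr.
rewrite -(fnorm_sqr B) -(fnorm_tr B) fnorm_sqr /dot.
rewrite mulr_suml; apply: ler_sum => i _.
rewrite mulr_sumr; apply: ler_sum => j _.
have dot_row p' (C : 'M[R]_(p', n)) k : dot (row i A) (row k C) = \sum_l A i l * C k l.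
  by rewrite /dot big_ord1; apply: eq_bigr => l _; rewrite !mxE.
have -> : (A *m B) i j = dot (row i A) (row j B^T).
  by rewrite dot_row mxE; apply: eq_bigr => l _; rewrite mxE.
rewrite -expr2 -[X in X * _](dot_row _ A).
have -> : \sum_j0 B^T j j0 * B^T j j0 = fnorm (row j B^T) ^+ 2.
  by rewrite fnorm_sqr /dot big_ord1; apply: eq_bigr => l _; rewrite !mxE.
rewrite -fnorm_sqr -exprMn -[leLHS]real_normK ?num_real//.
by rewrite ler_sqr ?nnegrE ?mulr_ge0 ?fnorm_ge0// ler_norml dot_le dot_ge.
Qed.

End Frobenius.

Section SpectralNorm.
Variables (R : realType) (n : nat).
Implicit Types (A : 'M[R]_n) (u v : 'rV[R]_n).

Lemma fnorm_mulmx_spectral A (v : 'cV[R]_n) :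
  fnorm (A *m v) <= spectral_norm A * fnorm v.
Proof.
have [->|v0] := eqVneq v 0; first by rewrite mulmx0 !fnorm0 mulr0.
have vgt0 : 0 < fnorm v by rewrite fnorm_gt0.
rewrite -ler_pdivrMr//; apply: ub_le_sup.
  (* The Frobenius norm bounds the set, so its [sup] is a genuine supremum and not a default
     value. *)
  exists (fnorm A) => _ /= [w w1 <-]; apply: le_trans (fnormM _ _) _.
  by rewrite ler_piMr// fnorm_ge0.
exists ((fnorm v)^-1 *: v); rewrite /= ?fnormZ ?gtr0_norm ?invr_gt0 ?mulVf ?gt_eqF//.
by rewrite -scalemxAr fnormZ gtr0_norm ?invr_gt0// mulrC.
Qed.

Lemma dot_mulmx_fnorm A u v : `|dot (u *m A) v| <= fnorm A * fnorm u * fnorm v.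
Proof.
have h : fnorm (u *m A) * fnorm v <= fnorm A * fnorm u * fnorm v.
  by rewrite ler_wpM2r ?fnorm_ge0// [leRHS]mulrC fnormM.
rewrite ler_norml; have := dot_le (u *m A) v; have := dot_ge (u *m A) v.
lra.
Qed.

Lemma dot_mulmx_spectral A u v :
  `|dot (u *m A) v| <= spectral_norm A * fnorm u * fnorm v.
Proof.
have -> : dot (u *m A) v = dot u (A *m v^T)^T.
  by rewrite -!mulmx_tr_dot trmxK mulmxA.
have : fnorm u * fnorm (A *m v^T)^T <= spectral_norm A * fnorm u * fnorm v.
  rewrite fnorm_tr [leRHS]mulrAC [leRHS]mulrC ler_wpM2l ?fnorm_ge0//.
  by rewrite -(fnorm_tr v) fnorm_mulmx_spectral.
have := dot_le u (A *m v^T)^T; have := dot_ge u (A *m v^T)^T.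
by rewrite ler_norml; lra.
Qed.

(* The bound also covers an empty spectrum, where lambda_min A = 0. *)
Lemma lambda_min_ge A c : 0 <= c ->
  (forall v, - c * fnorm v ^+ 2 <= dot (v *m A) v) -> - c <= lambda_min A.
Proof.
move=> c0 hA; rewrite /lambda_min.
have [->|/set0P[a0 Sa0]] := eqVneq [set a | eigenvalue A a] set0.
  by rewrite inf0 oppr_le0.
apply: lb_le_inf; first by exists a0.
move=> a /= /eigenvalueP[v vA v0].
have := hA v; rewrite vA dotZl -fnorm_sqr ler_pM2r//.
by rewrite exprn_gt0// fnorm_gt0.
Qed.

End SpectralNorm.

(** * Minimizers of the cubic model *)

(** The limit t -> 0+ made explicit, for reading conditions off small perturbations. *)
Lemma quadratic_limit_ge0 (R : realFieldType) (a b c : R) :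
  (forall t : R, 0 < t -> 0 <= a + t * b + t ^+ 2 * c) -> 0 <= a.
Proof.
move=> h; rewrite leNgt; apply/negP => a0.
pose C := `|b| + `|c| + 1; have C0 : 0 < C by rewrite ltr_wpDl ?addr_ge0.
(* With [t <= 1] and [t * C <= - a / 2], the terms in [b] and [c] add up to at most [- a / 2], so
   the sum stays negative. *)
pose t := Num.min 1 (- a / 2 / C).
have t0 : 0 < t by rewrite lt_min ltr01 !divr_gt0 ?oppr_gt0.
have t1 : t <= 1 by rewrite ge_min lexx.
have tC : t * C <= - a / 2 by rewrite -ler_pdivlMr// ge_min lexx orbT.
have tb : t * b <= t * `|b| by rewrite ler_pM2l// ler_norm.
have tc : t ^+ 2 * c <= t * `|c|.
  rewrite expr2 -mulrA ler_pM2l//; apply: le_trans (ler_norm _) _.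
  by rewrite normrM gtr0_norm// ler_piMl.
by have := h _ t0; rewrite /C in tC; lra.
Qed.

Section CubicModel.
Variables (R : realType) (n : nat) (g : 'rV[R]_n) (M : 'M[R]_n) (eta : R).
Variable s : 'rV[R]_n.
Implicit Types u v w : 'rV[R]_n.
Hypothesis eta0 : 0 < eta.
Hypothesis s_min : forall w, cubic_model g M eta s <= cubic_model g M eta w.

Local Notation r := (fnorm s / (2 * eta)).

Lemma cubic_modelE w : cubic_model g M eta w =
  dot g w + 2^-1 * dot (w *m M) w + (6 * eta)^-1 * fnorm w ^+ 3.
Proof. by rewrite /cubic_model !mulmx_tr_dot. Qed.

Local Notation symM := (2^-1 *: (M + M^T)).

Let dot_sym u v : dot (u *m symM) v = 2^-1 * (dot (u *m M) v + dot (v *m M) u).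
Proof. by rewrite -scalemxAr dotZl mulmxDr dotDl -(dot_mulmx_tr v u). Qed.

(** Optimality against [s + t *: w], with the cube of the norm bounded by [fnormD_cube]. The
    coefficient of t gives stationarity. That of t^2 would only give curvature at least -2r, twice
    the sharp bound, hence the reflection argument further on. *)
Let cubic_model_perturb (t : R) w :
  0 <= t * dot (g + s *m symM + r *: s) w
       + t ^+ 2 * (2^-1 * dot (w *m M) w + r * fnorm w ^+ 2)
       + (6 * eta)^-1 * (`|t| * fnorm w) ^+ 3.
Proof.
have := s_min (s + t *: w); rewrite !cubic_modelE.
have := fnormD_cube s (t *: w); rewrite fnormZ dotZr.
rewrite !(mulmxDl, dotDl, dotDr) -!scalemxAl !(dotZl, dotZr) dot_sym.
have -> : (`|t| * fnorm w) ^+ 2 = t ^+ 2 * fnorm w ^+ 2.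
  by rewrite exprMn real_normK ?num_real.
pose N : R := fnorm (s + t *: w) ^+ 3; pose c : R := (6 * eta)^-1.
pose v : R := (`|t| * fnorm w) ^+ 3; rewrite -/N -/c -/v.
have c0 : 0 <= c by rewrite invr_ge0 mulr_ge0// ltW.
have -> : r = 3 * fnorm s * c.
  by rewrite /c; field; rewrite gt_eqF.
by move=> /(ler_wpM2l c0) h1 h2; lra.
Qed.

Lemma cubic_model_stationary : g + s *m symM = - r *: s.
Proof.
apply/eqP; rewrite scaleNr -addr_eq0 -fnorm_eq0 -sqrf_eq0 eq_le sqr_ge0 andbT.
set v := g + _ + _; rewrite -oppr_ge0.
(* Moving along [- t *: v] contributes [- t * fnorm v ^+ 2] at first order, so a nonzero residual
   [v] would decrease the model. *)
apply: (@quadratic_limit_ge0 _ _ (2^-1 * dot (v *m M) v + r * fnorm v ^+ 2)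
         ((6 * eta)^-1 * fnorm v ^+ 3)) => t t0.
rewrite -(pmulr_rge0 _ t0); have := cubic_model_perturb (- t) v.
by rewrite normrN gtr0_norm// -/v -fnorm_sqr => /le_trans; apply; lra.
Qed.

(* Reflecting s across the hyperplane orthogonal to w preserves the cubic term;
   when s is orthogonal to w, perturb w along s. *)
Lemma cubic_model_curvature w : - r * fnorm w ^+ 2 <= dot (w *m M) w.
Proof.
have r0 : 0 <= r by rewrite divr_ge0 ?fnorm_ge0// mulr_ge0// ltW.
have reflect v : dot s v != 0 -> 0 <= dot (v *m M) v + r * fnorm v ^+ 2.
  move=> sv; have v0 : v != 0.
    by apply: contraNneq sv => ->; rewrite -(scale0r 0) dotZr mul0r.
  have N0 : 0 < fnorm v by rewrite fnorm_gt0.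
  pose t := - (2 * dot s v) / fnorm v ^+ 2.
  have tN : t * fnorm v ^+ 2 = - 2 * dot s v.
    by rewrite /t mulfVK ?expf_neq0 ?gt_eqF// mulNr.
  have t0 : 0 < t ^+ 2.
    rewrite exprn_even_gt0//=; apply: contraNneq sv => t0.
    by move: tN; rewrite t0 mul0r => ?; apply/eqP; lra.
  have fs : fnorm (s + t *: v) = fnorm s.
    apply/eqP; rewrite -(@eqrXn2 _ 2) ?fnorm_ge0// fnormD_sqr fnormZ dotZr.
    rewrite exprMn real_normK ?num_real//; apply/eqP.
    by transitivity (fnorm s ^+ 2 + t * (2 * dot s v + t * fnorm v ^+ 2)); [|rewrite tN]; ring.
  (* The cubic terms cancel. Stationarity replaces [dot g v], and [tN] turns the remaining multiple
     of [dot s v] into one of [t * r * fnorm v ^+ 2]: what is left is half of [t ^+ 2] times the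
     claim. *)
  have := s_min (s + t *: v); rewrite !cubic_modelE fs.
  have : dot (g + s *m symM) v = dot (- r *: s) v by rewrite cubic_model_stationary.
  rewrite !(mulmxDl, dotDl, dotDr) -!scalemxAl !(dotZl, dotZr) dot_sym => h1 h2.
  have : 0 <= t ^+ 2 * (dot (v *m M) v + r * fnorm v ^+ 2).
    have -> : t ^+ 2 * (dot (v *m M) v + r * fnorm v ^+ 2) =
      t ^+ 2 * dot (v *m M) v + t * r * (t * fnorm v ^+ 2) by ring.
    rewrite tN.
    have : dot g v = - r * dot s v - 2^-1 * (dot (s *m M) v + dot (v *m M) s) by lra.
    by move=> h; rewrite h in h2; lra.
  by rewrite pmulr_rge0.
have [s0|s0] := eqVneq s 0.
  have r00 : r = 0 by rewrite s0 fnorm0 mul0r.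
  (* At [s = 0] there is nothing to reflect, but [r] and the linear term vanish, so the direct
     perturbation is already sharp. *)
  suff : 0 <= 2^-1 * dot (w *m M) w by rewrite r00; lra.
  apply: (@quadratic_limit_ge0 _ _ ((6 * eta)^-1 * fnorm w ^+ 3) 0) => t t0.
  have t2 : 0 < t ^+ 2 by rewrite exprn_gt0.
  rewrite -(pmulr_rge0 _ t2); have := cubic_model_perturb t w.
  rewrite cubic_model_stationary r00 s0 oppr0 !scale0r addr0.
  rewrite -(scale0r 0) dotZl gtr0_norm//.
  by move=> /le_trans; apply; lra.
have [sw|sw] := eqVneq (dot s w) 0; last by have := reflect _ sw; lra.
suff : 0 <= dot (w *m M) w + r * fnorm w ^+ 2 by lra.
apply: (@quadratic_limit_ge0 _ _ (dot (w *m M) s + dot (s *m M) w)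
          (dot (s *m M) s + r * fnorm s ^+ 2)) => t t0.
have : dot s (w + t *: s) != 0.
  by rewrite dotDr dotZr sw add0r mulf_neq0 ?gt_eqF// -fnorm_sqr exprn_gt0// fnorm_gt0.
move=> /reflect; rewrite fnormD_sqr fnormZ exprMn real_normK ?num_real//.
rewrite !(mulmxDl, dotDl, dotDr) -!scalemxAl !(dotZl, dotZr) (dotC w s) sw.
by move=> /le_trans; apply; lra.
Qed.

(** Stationarity tested on [s] makes the linear term - s M s - r |s|^2; with the curvature bound in
    direction [s], the model is at most (1/2 - 1 + 1/3) r |s|^2. *)
Lemma cubic_model_decrease : cubic_model g M eta s <= - (fnorm s ^+ 3 / (12 * eta)).
Proof.
rewrite cubic_modelE.
have := cubic_model_curvature s.
have : dot (g + s *m symM) s = dot (- r *: s) s by rewrite cubic_model_stationary.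
rewrite dotDl dotZl dot_sym -fnorm_sqr.
have -> : (6 * eta)^-1 * fnorm s ^+ 3 = 3^-1 * (r * fnorm s ^+ 2).
  by field; rewrite gt_eqF.
have -> : fnorm s ^+ 3 / (12 * eta) = 6^-1 * (r * fnorm s ^+ 2).
  by field; rewrite gt_eqF.
lra.
Qed.

End CubicModel.

(** * Second-order Taylor bounds *)

(** Subtracting the antiderivative of the bound reduces the claim to the mean value theorem. Zero
    coefficients give the lower orders. *)
Lemma derive_le_cubic (R : realType) (F dF : R -> R) (a b c : R) :
  (forall t : R, is_derive t (1 : R) F (dF t)) ->
  (forall t : R, 0 <= t <= 1 -> dF t <= a + 2 * b * t + 3 * c * t ^+ 2) ->
  F 1 <= F 0 + a + b + c.
Proof.
move=> Fd dF_le; pose p : {poly R} := a%:P * 'X + b%:P * 'X^2 + c%:P * 'X^3.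
have hd (t : R) : is_derive t (1 : R) (F - horner p)
    (dF t - (a + 2 * b * t + 3 * c * t ^+ 2)).
  apply: is_derive_eq; rewrite /p !(derivD, derivM, derivC, derivXn, derivX).
  by rewrite !hornerE /=; ring.
have [|t] := @MVT R _ _ 0 1 ltr01 (fun t _ => hd t).
  apply: continuous_subspaceT => t.
  by apply: differentiable_continuous; apply/derivable1_diffP; case: (hd t).
rewrite in_itv/= => /andP[/ltW t0 /ltW t1]; rewrite subr0 mulr1 !fctE => h.
have := dF_le t; rewrite t0 t1 => /(_ isT); move: h; rewrite /p !hornerE /=; lra.
Qed.

Lemma is_derive_line (R : realType) (V : normedModType R) (F : V -> R) (x s : V)
    (t l : R) :
  is_derive (x + t *: s) s F l -> is_derive t (1 : R) (fun r : R => F (x + r *: s)) l.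
Proof.
move=> [Fd Fl].
have E : (fun h : R => h^-1 *: (F (x + (h *: 1 + t) *: s) - F (x + t *: s)))
   = (fun h : R => h^-1 *: (F (h *: s + (x + t *: s)) - F (x + t *: s))).
  apply/funext => h; congr (_ *: (F _ - _)).
  by rewrite /= [h *: 1]mulr1 scalerDl addrCA.
by split; [rewrite /derivable/= E|rewrite /derive/= E].
Qed.

Section SecondOrderTaylor.
Variables (R : realType) (n : nat) (f : 'rV[R]_n -> R).
Hypothesis f_C2 : twice_continuously_differentiable f.
Implicit Types x s w : 'rV[R]_n.

Lemma diff_coord_sum (F : 'rV[R]_n -> R) x s : differentiable F x ->
  is_derive x s F (\sum_i s 0 i * 'D_(delta_mx 0 i) F x).
Proof.
move=> Fd; split; first exact: diff_derivable.
rewrite deriveE// {1}(row_sum_delta s) linear_sum; apply: eq_bigr => i _.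
by rewrite linearZ/= deriveE.
Qed.

Lemma is_derive_grad x s : is_derive x s f (dot (grad f x) s).
Proof.
case: f_C2 => fd _ _; have := diff_coord_sum s (fd x).
rewrite /dot big_ord1; congr is_derive.
by apply: eq_bigr => i _; rewrite mxE mulrC.
Qed.

(** [hess] puts the outer derivative on the row index, so the direction of differentiation
    multiplies on the left; the order matters until [hess_sym] is available. *)
Lemma is_derive_hess x s w :
  is_derive x s (fun y => dot (grad f y) w) (dot (s *m hess f x) w).
Proof.
case: f_C2 => _ gd _.
have jd j : differentiable ('D_(delta_mx 0 j) f) x.
  have -> : 'D_(delta_mx 0 j) f = (fun M : 'rV[R]_n => M 0 j : R) \o grad f.
    by apply/funext => y; rewrite /= mxE.
  by apply: differentiable_comp; [exact: gd|exact: differentiable_coord].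
have -> : (fun y => dot (grad f y) w) = \sum_j (w 0 j *: 'D_(delta_mx 0 j) f).
  apply/funext => y; rewrite /dot big_ord1 fct_sumE; apply: eq_bigr => j _.
  by rewrite mxE mulrC.
have -> : dot (s *m hess f x) w =
    \sum_j w 0 j *: (\sum_i s 0 i * 'D_(delta_mx 0 i) ('D_(delta_mx 0 j) f) x).
  rewrite /dot big_ord1; apply: eq_bigr => j _; rewrite mxE mulrC; congr (_ * _).
  by apply: eq_bigr => i _; rewrite mxE.
by apply: is_derive_sum => j; apply: is_deriveZ; exact: diff_coord_sum.
Qed.

Variable L : R.
Hypothesis L_ge0 : 0 <= L.
Hypothesis hess_lip : forall x y,
  spectral_norm (hess f y - hess f x) <= L * fnorm (y - x).

Lemma hess_form_lip x y s w :
  dot (s *m (hess f y - hess f x)) w <= L * fnorm (y - x) * fnorm s * fnorm w.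
Proof.
apply: le_trans (ler_norm _) (le_trans (dot_mulmx_spectral _ _ _) _).
by rewrite !ler_wpM2r ?fnorm_ge0.
Qed.

Lemma grad_taylor_dot x s w :
  dot (grad f (x + s) - grad f x - s *m hess f x) w <= L / 2 * fnorm s ^+ 2 * fnorm w.
Proof.
have hd t := is_derive_line (is_derive_hess (x + t *: s) s w).
have : forall t : R, 0 <= t <= 1 -> dot (s *m hess f (x + t *: s)) w <=
    dot (s *m hess f x) w + 2 * (L / 2 * fnorm s ^+ 2 * fnorm w) * t + 3 * 0 * t ^+ 2.
  move=> t /andP[t0 t1]; have := hess_form_lip x (x + t *: s) s w.
  rewrite [x + _]addrC addrK fnormZ ger0_norm//.
  by move: (hess f _) (hess f x) => A B; rewrite mulmxBr dotDl dotNl; lra.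
move=> /(derive_le_cubic hd); rewrite scale1r scale0r !addr0.
by move: (grad f _) (grad f x) => g g'; rewrite !dotDl !dotNl; lra.
Qed.

Lemma grad_taylor x s :
  fnorm (grad f (x + s) - grad f x - s *m hess f x) <= L / 2 * fnorm s ^+ 2.
Proof.
set r := _ - _ - _; have := grad_taylor_dot x s r; rewrite -/r -fnorm_sqr expr2.
have [->|r0] := eqVneq r 0; last by rewrite ler_pM2r// fnorm_gt0.
by rewrite fnorm0 => _; rewrite mulr_ge0 ?divr_ge0 ?sqr_ge0.
Qed.

Lemma taylor2 x s :
  f (x + s) <= f x + dot (grad f x) s + 2^-1 * dot (s *m hess f x) s
               + L / 6 * fnorm s ^+ 3.
Proof.
have hd t := is_derive_line (is_derive_grad (x + t *: s) s).
have : forall t : R, 0 <= t <= 1 -> dot (grad f (x + t *: s)) s <=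
    dot (grad f x) s + 2 * (2^-1 * dot (s *m hess f x) s) * t
    + 3 * (L / 6 * fnorm s ^+ 3) * t ^+ 2.
  move=> t /andP[t0 t1]; have := grad_taylor_dot x (t *: s) s.
  rewrite fnormZ ger0_norm// -scalemxAl.
  by move: (grad f _) (grad f x) => g g'; rewrite !dotDl !dotNl dotZl; lra.
by move=> /(derive_le_cubic hd); rewrite scale1r scale0r !addr0.
Qed.

(** The difference of f along x + t w and x + s + t w is differentiated in t, and both gradients are
    expanded at x: the terms in t w cancel, the Hessian form in s and w remains, and each remainder
    is at most L/2 (|s| + |w|)^3. *)
Let double_difference_ge x s w :
  dot (s *m hess f x) w - L * (fnorm s + fnorm w) ^+ 3 <=
  f (x + s + w) - f (x + s) - f (x + w) + f x.
Proof.
set N := fnorm s + fnorm w.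
have s0 := fnorm_ge0 s; have w0 := fnorm_ge0 w.
have wN : fnorm w <= N by rewrite lerDr.
have N0 : 0 <= N by rewrite addr_ge0.
have hd (t : R) : is_derive t (1 : R)
    ((fun t : R => f (x + t *: w)) - (fun t : R => f (x + s + t *: w)))
    (dot (grad f (x + t *: w)) w - dot (grad f (x + s + t *: w)) w).
  by apply: is_deriveB; apply: is_derive_line; exact: is_derive_grad.
have : forall t : R, 0 <= t <= 1 ->
    dot (grad f (x + t *: w)) w - dot (grad f (x + s + t *: w)) w <=
    L * N ^+ 3 - dot (s *m hess f x) w + 2 * 0 * t + 3 * 0 * t ^+ 2.
  move=> t /andP[t0 t1].
  have tw : fnorm (t *: w) <= fnorm w by rewrite fnormZ ger0_norm// ler_piMl.
  have cube (v : 'rV[R]_n) : fnorm v <= N -> L / 2 * fnorm v ^+ 2 * fnorm w <= L / 2 * N ^+ 3.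
    move=> vN; rewrite -mulrA ler_wpM2l ?divr_ge0// (exprSr N 2).
    by rewrite ler_pM ?sqr_ge0 ?ler_sqr ?nnegrE ?fnorm_ge0.
  have := grad_taylor_dot x (t *: w) w.
  have := grad_taylor_dot x (s + t *: w) (- w).
  have := cube (t *: w) (le_trans tw wN).
  have := cube (s + t *: w) (le_trans (fnormD _ _) (lerD (lexx _) tw)).
  rewrite fnormN addrA; move: (grad f (x + s + _)) (grad f (x + t *: w)) (grad f x).
  by move=> g1 g2 g3; rewrite mulmxDl !dotDl !dotNl !dotNr dotDl; lra.
move=> /(derive_le_cubic hd); rewrite !fctE !scale1r !scale0r !addr0.
by move: (f (x + s + w)) (f (x + s)) (f (x + w)) (f x) => *; lra.
Qed.

(* The double difference is symmetric in s and w; its upper bound is its lower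
   bound from x + w along (s, - w). *)
Lemma hess_sym x : (hess f x)^T = hess f x.
Proof.
have N0 s w : 0 <= fnorm s + fnorm w by rewrite addr_ge0 ?fnorm_ge0.
have asym s w : dot (s *m hess f x) w - dot (w *m hess f x) s
    <= 3 * L * (fnorm s + fnorm w) ^+ 3.
  have := double_difference_ge x s w.
  have := double_difference_ge (x + s) w (- s).
  have -> : x + s + w - s = x + w by rewrite addrAC addrK.
  have -> : x + s - s = x by rewrite addrK.
  have := hess_form_lip x (x + s) w s.
  have -> : x + s - x = s by rewrite addrC addKr.
  move: (f (x + s + w)) (f (x + s)) (f (x + w)) (f x) (hess f (x + s)) (hess f x).
  move=> f1 f2 f3 f4 A B; rewrite mulmxBr dotDl dotNl dotNr (fnormN s) (addrC (fnorm w)).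
  have : L * fnorm s * fnorm w * fnorm s <= L * (fnorm s + fnorm w) ^+ 3.
    rewrite -!mulrA ler_wpM2l// mulrA mulrAC -expr2 [leRHS]exprSr.
    by rewrite ler_pM ?sqr_ge0 ?fnorm_ge0 ?ler_sqr ?nnegrE// ?lerDl ?lerDr ?fnorm_ge0.
  lra.
have le s w : dot (s *m hess f x) w <= dot (w *m hess f x) s.
  (* Scaling [s] and [w] by t makes the asymmetry quadratic in t and its bound cubic. *)
  rewrite -subr_ge0; apply: (@quadratic_limit_ge0 _ _ (3 * L * (fnorm s + fnorm w) ^+ 3) 0) => t t0.
  have := asym (t *: s) (t *: w); rewrite !fnormZ gtr0_norm// -!scalemxAl !dotZl !dotZr.
  rewrite -(pmulr_rge0 _ (exprn_gt0 2 t0)).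
  move: (dot (s *m _) w) (dot (w *m _) s) => a b; lra.
apply/matrixP => i j; rewrite mxE.
have dotE (A : 'M[R]_n) k l : dot ((delta_mx 0 k : 'rV_n) *m A) (delta_mx 0 l) = A k l.
  by rewrite -mulmx_tr_dot trmx_delta -rowE -colE !mxE.
by apply/eqP; rewrite eq_le -!(dotE (hess f x)) !le.
Qed.

End SecondOrderTaylor.

(** * One step of the method *)

Lemma young_cube (R : realFieldType) (t x y : R) : 0 < t -> 0 <= x -> 0 <= y ->
  3 * x * y ^+ 2 <= t ^+ 2 * x ^+ 3 + 2 / t * y ^+ 3.
Proof.
move=> t0 x0 y0; rewrite -subr_ge0.
have -> : t ^+ 2 * x ^+ 3 + 2 / t * y ^+ 3 - 3 * x * y ^+ 2 =
    (t * x - y) ^+ 2 * (t * x + 2 * y) / t by field; rewrite gt_eqF.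
by rewrite divr_ge0 ?(ltW t0)// mulr_ge0 ?sqr_ge0// addr_ge0// mulr_ge0// ltW.
Qed.

Lemma cube_convex (R : realFieldType) (t x y : R) : 0 <= t <= 1 -> 0 <= x -> 0 <= y ->
  ((1 - t) * x + t * y) ^+ 3 <= (1 - t) * x ^+ 3 + t * y ^+ 3.
Proof.
move=> /andP[t0 t1] x0 y0; rewrite -subr_ge0.
have -> : (1 - t) * x ^+ 3 + t * y ^+ 3 - ((1 - t) * x + t * y) ^+ 3 =
    t * (1 - t) * (x - y) ^+ 2 * ((2 - t) * x + (1 + t) * y) by ring.
have t1' : 0 <= 1 - t by lra.
have t2' : 0 <= 2 - t by lra.
have t3' : 0 <= 1 + t by lra.
by apply: mulr_ge0; [rewrite mulr_ge0 ?sqr_ge0 ?mulr_ge0|rewrite addr_ge0 ?mulr_ge0].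
Qed.

(** Convexity of the cube for the weights 1 - t and t, after rescaling [B] by (1 - t) / t: the
    factor 1 - t on [A] survives, and [B] pays t^(-2). *)
Lemma fnorm_convex_cube (R : realType) m n (A B : 'M[R]_(m, n)) (t : R) : 0 < t <= 1 ->
  fnorm ((1 - t) *: (A + B)) ^+ 3 <=
  (1 - t) * fnorm A ^+ 3 + (1 - t) / t ^+ 2 * fnorm B ^+ 3.
Proof.
move=> /andP[t0 t1]; have t1' : 0 <= 1 - t by lra.
have a0 := fnorm_ge0 A; have b0 := fnorm_ge0 B.
have h : fnorm ((1 - t) *: (A + B)) <= (1 - t) * fnorm A + t * ((1 - t) / t * fnorm B).
  rewrite fnormZ ger0_norm// mulrA mulrCA divff ?gt_eqF// mulr1 -mulrDr.
  by rewrite ler_wpM2l// fnormD.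
have c0 : 0 <= (1 - t) / t * fnorm B by rewrite mulr_ge0// divr_ge0// ltW.
have ht : 0 <= t <= 1 by lra.
apply: le_trans (le_trans (cube_convex ht a0 c0) _).
  by rewrite lerXn2r// nnegrE ?fnorm_ge0// addr_ge0// mulr_ge0// ltW.
rewrite lerD2l.
have -> : t * ((1 - t) / t * fnorm B) ^+ 3 =
    (1 - t) ^+ 2 * ((1 - t) / t ^+ 2 * fnorm B ^+ 3) by field; rewrite gt_eqF.
rewrite ler_piMl ?exprn_ile1//; last lra.
by rewrite mulr_ge0 ?exprn_ge0// divr_ge0// exprn_ge0// ltW.
Qed.

Lemma fnormD_cube_young (R : realType) m n (A B : 'M[R]_(m, n)) (t : R) : 0 < t ->
  fnorm (A + B) ^+ 3 <= (1 + t ^+ 2) * fnorm A ^+ 3 + 3 * fnorm A * dot A B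
                        + (1 + 2 / t) * fnorm B ^+ 3.
Proof.
move=> t0; have := fnormD_cube A B.
by have := young_cube t0 (fnorm_ge0 A) (fnorm_ge0 B); lra.
Qed.

Section Step.
Variables (R : realType) (n : nat) (f : 'rV[R]_n -> R) (L q : R).
Hypothesis f_C2 : twice_continuously_differentiable f.
Hypothesis hess_lip : forall x y,
  spectral_norm (hess f y - hess f x) <= L * fnorm (y - x).
Hypothesis L_ge0 : 0 <= L.
Hypothesis q_gt0 : 0 < q.
Hypothesis L_le : L <= 9 / 2 * q ^+ 2.
Variables (x g s : 'rV[R]_n) (M : 'M[R]_n).
Let eta := (9 * q ^+ 2)^-1.
Hypothesis s_min : forall w, cubic_model g M eta s <= cubic_model g M eta w.

Let eg := fnorm (g - grad f x).
Let eH := fnorm (M - hess f x).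
Let r := fnorm s.

Let eta_gt0 : 0 < eta.
Proof. by rewrite invr_gt0 mulr_gt0// exprn_gt0. Qed.

Let fnorm_over_eta (w : 'rV[R]_n) : fnorm w / (2 * eta) = 9 / 2 * q ^+ 2 * fnorm w.
Proof. by rewrite /eta; field; rewrite gt_eqF. Qed.

Lemma cubic_step_decrease : f (x + s) + 3 / 4 * q ^+ 2 * r ^+ 3 <=
  f x + 4 / (3 * q) * Num.sqrt eg ^+ 3 + eH ^+ 3 / (24 * q ^+ 4).
Proof.
have r0 : 0 <= r := fnorm_ge0 s.
have := taylor2 f_C2 hess_lip x s.
have := cubic_model_decrease eta_gt0 s_min; rewrite cubic_modelE -/r.
have -> : r ^+ 3 / (12 * eta) = 3 / 4 * q ^+ 2 * r ^+ 3.
  by rewrite /eta; field; rewrite gt_eqF.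
have -> : (6 * eta)^-1 * r ^+ 3 = 3 / 2 * q ^+ 2 * r ^+ 3.
  by rewrite /eta; field; rewrite gt_eqF.
have : L / 6 * r ^+ 3 <= 3 / 4 * q ^+ 2 * r ^+ 3 by rewrite ler_wpM2r ?exprn_ge0//; move: L_le; lra.
have : - (eg * r) <= dot (g - grad f x) s by exact: dot_ge.
have := dot_mulmx_fnorm (M - hess f x) s s; rewrite ler_norml => /andP[+ _].
rewrite -/eH -/r.
move: (f (x + s)) (f x) => f1 f0; rewrite mulmxBr !dotDl !dotNl.
(* Apart from the errors, the cubic terms leave -(3/2) q^2 r^3. The Young parameters spend q^2 r^3 /
   12 on the gradient error and (2/3) q^2 r^3 on the Hessian error, which leaves exactly 3/4. *)
have : 3 * r * Num.sqrt eg ^+ 2 <= (q / 2) ^+ 2 * r ^+ 3 + 2 / (q / 2) * Num.sqrt eg ^+ 3.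
  by apply: young_cube; rewrite ?divr_gt0 ?sqrtr_ge0.
rewrite sqr_sqrtr ?fnorm_ge0//.
have : 3 * eH * r ^+ 2 <= ((2 * q ^+ 2)^-1) ^+ 2 * eH ^+ 3 + 2 / (2 * q ^+ 2)^-1 * r ^+ 3.
  by apply: young_cube; rewrite ?invr_gt0 ?mulr_gt0 ?exprn_gt0 ?fnorm_ge0.
have -> : (2 * q ^+ 2)^-1 ^+ 2 * eH ^+ 3 = 6 * (eH ^+ 3 / (24 * q ^+ 4)).
  by field; rewrite gt_eqF.
have -> : 2 / (2 * q ^+ 2)^-1 * r ^+ 3 = 4 * (q ^+ 2 * r ^+ 3).
  by field; rewrite gt_eqF.
have -> : 2 / (q / 2) * Num.sqrt eg ^+ 3 = 3 * (4 / (3 * q) * Num.sqrt eg ^+ 3).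
  by field; rewrite gt_eqF.
rewrite -/r; lra.
Qed.

Lemma cubic_step_grad :
  fnorm (grad f (x + s)) <= 27 / 4 * q ^+ 2 * r ^+ 2 + eg + eH * r.
Proof.
have r0 : 0 <= r := fnorm_ge0 s.
have stat := cubic_model_stationary eta_gt0 s_min.
rewrite fnorm_over_eta -/r in stat.
(* As the Hessian is symmetric, [E] is the symmetric part of hess f x - M, of norm at most [eH]. *)
pose E := hess f x - 2^-1 *: (M + M^T).
have E_le : fnorm (s *m E) <= eH * r.
  apply: le_trans (fnormM _ _) _; rewrite mulrC ler_wpM2r//.
  have -> : E = 2^-1 *: ((hess f x - M) + (hess f x - M)^T).
    rewrite [(_ - M)^T]linearB /= (hess_sym f_C2 L_ge0 hess_lip) /E.
    by move: (hess f x) => A; apply/matrixP => i j; rewrite !mxE; field.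
  rewrite fnormZ gtr0_norm ?invr_gt0//; apply: (@le_trans _ _ (2^-1 * (eH + eH))); last lra.
  rewrite ler_wpM2l ?invr_ge0//; apply: le_trans (fnormD _ _) _.
  by rewrite fnorm_tr fnormB.
have -> : grad f (x + s) = (grad f (x + s) - grad f x - s *m hess f x)
    + (grad f x - g) + s *m E + - (9 / 2 * q ^+ 2 * r) *: s.
  rewrite -stat mulmxBr.
  move: (grad f (x + s)) (grad f x) (hess f x) => g1 g0 A.
  by apply/matrixP => i j; rewrite !mxE; ring.
apply: le_trans (fnormD _ _) _.
rewrite [in leLHS]fnormZ normrN ger0_norm ?mulr_ge0 ?exprn_ge0 ?(ltW q_gt0)//.
have := fnormD (grad f (x + s) - grad f x - s *m hess f x + (grad f x - g)) (s *m E).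
have := fnormD (grad f (x + s) - grad f x - s *m hess f x) (grad f x - g).
have := grad_taylor f_C2 L_ge0 hess_lip x s.
rewrite (fnormB (grad f x) g) -/eg -/r.
have : L / 2 * r ^+ 2 <= 9 / 4 * q ^+ 2 * r ^+ 2 by rewrite ler_wpM2r ?sqr_ge0//; move: L_le; lra.
lra.
Qed.

Lemma cubic_step_grad_cube : Num.sqrt (fnorm (grad f (x + s))) ^+ 3 <=
  32 * q ^+ 3 * r ^+ 3 + 2 * Num.sqrt eg ^+ 3 + eH ^+ 3 / q ^+ 3.
Proof.
have := cubic_step_grad.
set b := Num.sqrt _; set a := Num.sqrt eg; pose c := Num.sqrt (eH * r).
have b0 : 0 <= b by exact: sqrtr_ge0.
have a0 : 0 <= a by exact: sqrtr_ge0.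
have c0 : 0 <= c by exact: sqrtr_ge0.
have r0 : 0 <= r := fnorm_ge0 s.
have e0 : 0 <= eH := fnorm_ge0 _.
rewrite -[fnorm (grad f _)]sqr_sqrtr ?fnorm_ge0// -/b.
rewrite -[eg]sqr_sqrtr ?fnorm_ge0// -/a -[eH * r]sqr_sqrtr ?mulr_ge0// -/c => hb.
have c3 : c ^+ 3 <= (eH ^+ 3 / q ^+ 3 + q ^+ 3 * r ^+ 3) / 2.
  have h0 : 0 <= eH ^+ 3 / q ^+ 3 by rewrite divr_ge0 ?exprn_ge0// ltW.
  have h1 : 0 <= q ^+ 3 * r ^+ 3 by rewrite mulr_ge0 ?exprn_ge0// ltW.
  rewrite -ler_sqr ?nnegrE ?exprn_ge0 ?divr_ge0 ?addr_ge0//.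
  rewrite exprAC sqr_sqrtr ?mulr_ge0//.
  have -> : (eH * r) ^+ 3 = eH ^+ 3 / q ^+ 3 * (q ^+ 3 * r ^+ 3).
    by field; rewrite gt_eqF.
  have amgm (X Y : R) : X * Y <= ((X + Y) / 2) ^+ 2.
    rewrite -subr_ge0.
    have -> : ((X + Y) / 2) ^+ 2 - X * Y = ((X - Y) / 2) ^+ 2 by field.
    exact: sqr_ge0.
  exact: amgm.
(* (13/5)^2 = 6.76 just exceeds 27/4. Three Young inequalities with parameter 4/7 absorb (48/49) b^3
   out of 3 b^3, leaving the factor 343/198 on y^3 + a^3 + c^3. *)
pose y := 13 / 5 * q * r; have y0 : 0 <= y by rewrite !mulr_ge0// ltW.
have t0 : 0 < 4 / 7 :> R by [].
have := young_cube t0 b0 a0; have := young_cube t0 b0 c0; have := young_cube t0 b0 y0.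
have qr2 : 0 <= (q * r) ^+ 2 by exact: sqr_ge0.
have qr3 : 0 <= (q * r) ^+ 3 by rewrite exprn_ge0// mulr_ge0// ltW.
have a3 : 0 <= a ^+ 3 by rewrite exprn_ge0.
have e3 : 0 <= eH ^+ 3 / q ^+ 3 by rewrite divr_ge0 ?exprn_ge0// ltW.
have : b * b ^+ 2 <= b * (y ^+ 2 + a ^+ 2 + c ^+ 2).
  by rewrite ler_wpM2l// (le_trans hb)//; rewrite /y; lra.
rewrite /y; lra.
Qed.

Lemma cubic_step_curvature :
  - (4 * (eH ^+ 3 + 729 * q ^+ 6 * r ^+ 3)) <= lambda_min (hess f (x + s)) ^+ 3.
Proof.
have r0 : 0 <= r := fnorm_ge0 s.
have e0 : 0 <= eH := fnorm_ge0 _.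
have qr : 0 <= 9 * q ^+ 2 * r by rewrite !mulr_ge0// ltW.
(* Half of 9 q^2 r is the regularization, the other half bounds the change of the Hessian along the
   step, by [L_le]. *)
pose c := eH + 9 * q ^+ 2 * r; have c0 : 0 <= c by rewrite addr_ge0.
have lc : - c <= lambda_min (hess f (x + s)).
  apply: lambda_min_ge => // v.
  have := cubic_model_curvature eta_gt0 s_min v; rewrite fnorm_over_eta -/r.
  have := dot_mulmx_fnorm (M - hess f x) v v; rewrite ler_norml => /andP[_].
  have := dot_mulmx_spectral (hess f (x + s) - hess f x) v v.
  rewrite ler_norml -/eH => /andP[+ _].
  have := hess_lip x (x + s); have -> : x + s - x = s by rewrite addrC addKr.
  have v2 := sqr_ge0 (fnorm v); rewrite -/r => /(ler_wpM2r v2).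
  have : L * r * fnorm v ^+ 2 <= 9 / 2 * q ^+ 2 * r * fnorm v ^+ 2.
    by rewrite !ler_wpM2r.
  move: (spectral_norm (hess f (x + s) - hess f x)) (hess f (x + s)) (hess f x) => S A B.
  rewrite /c !mulmxBr !dotDl !dotNl; lra.
apply: (@le_trans _ _ (- c ^+ 3)).
  (* 4 (a^3 + b^3) - (a + b)^3 = 3 (a + b) (a - b)^2. *)
  have : 0 <= 3 * c * (eH - 9 * q ^+ 2 * r) ^+ 2.
    by apply: mulr_ge0; rewrite ?sqr_ge0 ?mulr_ge0.
  rewrite /c; lra.
move: (lambda_min (hess f (x + s))) lc => l lc; have [l0|/ltW l0] := leP 0 l.
  by apply: (@le_trans _ _ 0); rewrite ?oppr_le0 exprn_ge0.
have : (- l) ^+ 3 <= c ^+ 3.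
  by rewrite lerXn2r// ?nnegrE ?oppr_ge0// lerNl.
by rewrite exprNn -signr_odd /= mulN1r lerNl.
Qed.

End Step.

(** * Integration against independent samples *)

(** The integral of a nonnegative function is a supremum over simple functions below it, hence
    monotone even when measurability is not known. *)
Lemma ge0_le_integralT (d : measure_display) (T : measurableType d) (R : realType)
    (mu : {measure set T -> \bar R}) (f g : T -> \bar R) :
  (forall w, 0 <= f w)%E -> (forall w, f w <= g w)%E ->
  (\int[mu]_w f w <= \int[mu]_w g w)%E.
Proof.
move=> f0 fg; have g0 w : (0 <= g w)%E by exact: le_trans (fg w).
rewrite !ge0_integralTE//; apply: le_ereal_sup => _ [h hf <-].
by exists h => // w; exact: le_trans (fg w).
Qed.

Lemma integral_probability_cst (d : measure_display) (T : measurableType d)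
    (R : realType) (P : probability T R) (c : R) : (\int[P]_w c%:E = c%:E)%E.
Proof. by have := expectation_cst P c; rewrite unlock. Qed.

(** The positive part of [X] is discarded and the negative part dominated by [g], which may take the
    value +oo. *)
Lemma expectation_geN (d : measure_display) (T : measurableType d) (R : realType)
    (P : probability T R) (X : T -> R) (g : T -> \bar R) :
  (forall w, 0 <= g w)%E -> (forall w, - (X w)%:E <= g w)%E ->
  (- (\int[P]_w g w) <= 'E_P[X])%E.
Proof.
move=> g0 Xg; rewrite unlock [leRHS]integralE.
apply: (@le_trans _ _ (- (\int[P]_w (EFin \o X)^\- w))%E).
  rewrite leeN2. apply: ge0_le_integralT => w; first exact: funeneg_ge0.
  by rewrite funenegE ge_max g0 Xg.
by apply: leeDr; apply: integral_ge0 => w _; exact: funepos_ge0.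
Qed.

Section Independence.
Context (d d' : measure_display) (T : measurableType d) (D : measurableType d').
Context (R : realType) (P : probability T R) (Q : probability D R).
Variables (F : set_system T) (X : T -> D).
Local Notation TF := (g_sigma_algebraType F).
Hypothesis F_sub : forall A, F A -> measurable A.
Hypothesis mX : measurable_fun setT X.
Hypothesis X_law : forall B, measurable B -> P (X @^-1` B) = Q B.
Hypothesis FX_indep : forall A B, <<s F >> A -> measurable B ->
  P (A `&` X @^-1` B) = (P A * P (X @^-1` B))%E.

Lemma g_sigma_algebra_measurable (A : set T) : <<s F >> A -> measurable A.
Proof.
by apply: smallest_sub => //; exact: sigma_algebra_measurable.
Qed.

(** The identity into the sample space with its smaller sigma-algebra: its law is P restricted to
    that sigma-algebra, so [joint] pairs the whole past with the fresh sample. *)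
Let coarse (w : T) : TF := w.
Let mcoarse : measurable_fun setT coarse.
Proof. by move=> _ A mA; rewrite setTI; exact: g_sigma_algebra_measurable. Qed.

Let joint (w : T) : TF * D := (w, X w).
Let mjoint : measurable_fun setT joint.
Proof. exact: measurable_fun_pair. Qed.

Lemma indep_integral (h : TF * D -> \bar R) :
  measurable_fun [set: (TF * D)%type] h -> (forall z, 0 <= h z)%E ->
  (\int[P]_w h (w, X w) = \int[P]_w \int[Q]_s h (w, s))%E.
Proof.
move=> mh h0.
pose jm : {mfun T >-> (TF * D)%type} :=
  HB.pack joint (isMeasurableFun.Build _ _ _ _ _ mjoint).
pose cm : {mfun T >-> TF} := HB.pack coarse (isMeasurableFun.Build _ _ _ _ _ mcoarse).
pose PF : probability TF R := distribution P cm.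
transitivity (\int[distribution P jm]_z h z)%E.
  by rewrite ge0_integral_distribution.
transitivity (\int[PF \x Q]_z h z)%E.
  (* By independence the law of [joint] agrees with the product measure on rectangles, which
     determine it. *)
  apply: eq_measure_integral => A mA _; apply/esym.
  apply: product_measure_unique => // U V mU mV.
  transitivity (P (U `&` X @^-1` V)) => //.
  by rewrite FX_indep// X_law.
transitivity (\int[PF]_w \int[Q]_s h (w, s))%E.
  by rewrite fubini_tonelli1.
rewrite ge0_integral_distribution//; first exact: measurable_fun_fubini_tonelli_F.
by move=> w; apply: integral_ge0.
Qed.
End Independence.

Lemma continuous_borel_measurable (R : realType) (V : ptopologicalType) (phi : V -> R) :
  continuous phi -> measurable_fun [set: borel V] (phi : borel V -> R).
Proof.
move=> /continuousP cphi; apply: (measurability _ (RGenOpens.measurableE R)).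
move=> _ [_ [a [b ->]] <-]; rewrite setTI; apply: sub_sigma_algebra.
exact/cphi/interval_open.
Qed.

Section MatrixMeasurability.
Context (d : measure_display) (T : measurableType d) (R : realType).

Definition mx_measurable m n (A : T -> 'M[R]_(m, n)) : Prop :=
  forall i j, measurable_fun [set: T] (fun w => A w i j).

Section Rectangular.
Variables m n : nat.
Implicit Types A B : T -> 'M[R]_(m, n).

Lemma borel_mx_measurable A :
  measurable_fun [set: T] (A : T -> borel 'M[R]_(m, n)) -> mx_measurable A.
Proof.
move=> mA i j.
apply: (measurableT_comp (f := fun M : borel 'M[R]_(m, n) => M i j) _ mA).
by apply: continuous_borel_measurable; exact: coord_continuous.
Qed.

Lemma mx_measurableD A B :
  mx_measurable A -> mx_measurable B -> mx_measurable (fun w => A w + B w).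
Proof.
move=> mA mB i j; under eq_fun do rewrite mxE.
exact: measurable_funD.
Qed.

Lemma mx_measurableZ a A : mx_measurable A -> mx_measurable (fun w => a *: A w).
Proof.
move=> mA i j; under eq_fun do rewrite mxE.
by apply: measurable_funM => //; exact: measurable_cst.
Qed.

Lemma mx_measurableB A B :
  mx_measurable A -> mx_measurable B -> mx_measurable (fun w => A w - B w).
Proof.
move=> mA mB; under eq_fun do rewrite -scaleN1r.
exact/mx_measurableD/mx_measurableZ.
Qed.

Lemma measurable_fnorm A : mx_measurable A ->
  measurable_fun [set: T] (fun w => fnorm (A w)).
Proof.
move=> mA; apply: measurableT_comp.
  by apply: continuous_measurable_fun; exact: sqrt_continuous.
apply: measurable_sum => i; apply: measurable_sum => j.
exact: measurable_funX.
Qed.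

Lemma measurable_fnormX k A : mx_measurable A ->
  measurable_fun [set: T] (fun w => fnorm (A w) ^+ k).
Proof. by move=> mA; apply: measurable_funX; exact: measurable_fnorm. Qed.

End Rectangular.

Lemma continuous_mx_measurable n m p (F : 'rV[R]_n -> 'M[R]_(m, p)) (x : T -> 'rV[R]_n) :
  continuous F -> measurable_fun [set: T] (x : T -> borel 'rV[R]_n) ->
  mx_measurable (fun w => F (x w)).
Proof.
move=> cF mx i j.
apply: (measurableT_comp (f := fun y : borel 'rV[R]_n => F y i j) _ mx).
apply: continuous_borel_measurable => y.
by apply: (@continuous_comp _ _ _ F (fun M => M i j)); [exact: cF|exact: coord_continuous].
Qed.

End MatrixMeasurability.

Lemma g_sigma_algebra_mfun (T : pointedType) (F F' : set_system T)
    (d' : measure_display) (U : measurableType d') (f : T -> U) :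
  F `<=` <<s F' >> ->
  measurable_fun setT (f : g_sigma_algebraType F -> U) ->
  measurable_fun setT (f : g_sigma_algebraType F' -> U).
Proof.
move=> FF' mf _ B mB; have := mf measurableT B mB.
apply: smallest_sub => //; exact: smallest_sigma_algebra.
Qed.

(** * Third moment under a centered perturbation *)

Section CenteredNoise.
Context (d : measure_display) (S : measurableType d) (R : realType).
Variables (Q : probability S R) (m n : nat) (Y : S -> 'M[R]_(m, n)).
Variables (h : 'M[R]_(m, n)) (sigma : R).
Hypothesis mY : mx_measurable Y.
Hypothesis Y_mean : forall i j, (\int[Q]_s (Y s i j)%:E = (h i j)%:E)%E.
Hypothesis Y_dev :
  (\int[Q]_s (fnorm (Y s - h) ^+ 3)%:E <= (sigma ^+ 3)%:E)%E.

Let N s := fnorm (Y s - h) ^+ 3.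

Let N_ge0 s : 0 <= N s. Proof. by rewrite exprn_ge0// fnorm_ge0. Qed.

Let mN : measurable_fun setT N.
Proof.
apply: measurable_fnormX => i j; under eq_fun do rewrite mxE.
apply: measurable_funD; first exact: mY.
exact: measurable_cst.
Qed.

Let N_int : Q.-integrable setT (EFin \o N).
Proof.
apply/integrableP; split; first exact/measurable_EFinP.
under eq_integral do rewrite /= ger0_norm//.
by apply: le_lt_trans Y_dev _; rewrite ltry.
Qed.

Let dev i j s := Y s i j - h i j.

Let Y_int i j : Q.-integrable setT (EFin \o (fun s => Y s i j)).
Proof.
have cst_int : Q.-integrable setT (EFin \o cst (1 + `|h i j|)).
  exact: finite_measure_integrable_cst.
apply: (le_integrable _ _ _ (integrableD _ N_int cst_int)) => //.
  exact/measurable_EFinP/mY.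
move=> s _ /=; rewrite lee_fin [leRHS]ger0_norm ?addr_ge0//.
have := fnorm_entry (Y s - h) i j; rewrite 2!mxE => dev_le.
(* a <= 1 + a^3: the third moment controls the first, which makes the entries of [Y] integrable. *)
have : fnorm (Y s - h) <= 1 + N s.
  rewrite /N; have := fnorm_ge0 (Y s - h); move: (fnorm _) => a a0.
  have := @young_cube R 1 1 a ltr01 ler01 a0.
  have := sqr_ge0 (a - 1); have := mulr_ge0 a0 (sqr_ge0 (a - 1)); nra.
by have := ler_normD (Y s i j - h i j) (h i j); rewrite subrK; lra.
Qed.

Let dev_int i j : Q.-integrable setT (EFin \o dev i j).
Proof.
have := integrableB measurableT (Y_int i j) (finite_measure_integrable_cst Q (h i j) measurableT).
by congr (Q.-integrable _ _); apply/funext => s /=; rewrite EFinB.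
Qed.

Let dev_mean i j : (\int[Q]_s (dev i j s)%:E = 0)%E.
Proof.
rewrite /dev; under eq_integral do rewrite EFinB.
rewrite integralB_EFin//; last exact: finite_measure_integrable_cst.
by rewrite Y_mean integral_probability_cst subee.
Qed.

Let lin (a : R) (u : 'M[R]_(m, n)) s := a * dot u (Y s - h).

Let linE a u s : (lin a u s)%:E = (\sum_i \sum_j (a * u i j)%:E * (dev i j s)%:E)%E.
Proof.
rewrite /lin /dot mulr_sumr -sumEFin; apply: eq_bigr => i _.
rewrite mulr_sumr -sumEFin; apply: eq_bigr => j _.
by rewrite -EFinM /dev !mxE mulrA.
Qed.

Let lin_int a u : Q.-integrable setT (EFin \o lin a u).
Proof.
rewrite (_ : EFin \o _ = fun s => \sum_i \sum_j (a * u i j)%:E * (dev i j s)%:E)%E.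
  apply: integrable_sum => // i _; apply: integrable_sum => // j _.
  exact: (integrableZl measurableT _ (dev_int i j)).
by apply/funext => s; rewrite -linE.
Qed.

Let lin_mean a u : (\int[Q]_s (lin a u s)%:E = 0)%E.
Proof.
under eq_integral do rewrite linE.
rewrite integral_sum//; last first.
  by move=> i; apply: integrable_sum => // j _; exact: (integrableZl measurableT _ (dev_int i j)).
rewrite big1// => i _; rewrite integral_sum//; last first.
  by move=> j; exact: (integrableZl measurableT _ (dev_int i j)).
by rewrite big1// => j _; rewrite (integralZl measurableT (dev_int i j)) dev_mean mule0.
Qed.

(** The first-order term is linear in the noise and integrates to zero. With theta = t^2, the Young
    parameter (2/3) t limits the growth to 1 + (4/9) theta, which the momentum factor 1 - theta can
    absorb; the noise pays 3 t^5 + t^6 <= 4 t^5. *)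
Lemma noise_cube_le (u : 'M[R]_(m, n)) (t : R) : 0 < t <= 1 ->
  (\int[Q]_s (fnorm (u + t ^+ 2 *: (Y s - h)) ^+ 3)%:E <=
   ((1 + 4 / 9 * t ^+ 2) * fnorm u ^+ 3 + 4 * t ^+ 5 * sigma ^+ 3)%:E)%E.
Proof.
move=> /andP[t0 t1].
pose K0 := (1 + 4 / 9 * t ^+ 2) * fnorm u ^+ 3.
pose K1 := 3 * t ^+ 5 + t ^+ 6.
pose a := 3 * fnorm u * t ^+ 2.
have cst_int : Q.-integrable setT (EFin \o cst K0).
  exact: finite_measure_integrable_cst.
have K1N_int : Q.-integrable setT (fun s => K1%:E * (N s)%:E)%E by exact: (integrableZl measurableT _ N_int).
apply: (@le_trans _ _ (\int[Q]_s ((K0%:E + (lin a u s)%:E) + K1%:E * (N s)%:E))%E).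
  apply: ge0_le_integralT => s; first by rewrite lee_fin exprn_ge0// fnorm_ge0.
  rewrite -EFinM -!EFinD lee_fin.
  have t23 : 0 < 2 / 3 * t by rewrite mulr_gt0.
  apply: le_trans (fnormD_cube_young _ _ t23) _.
  rewrite dotZr fnormZ ger0_norm ?sqr_ge0//.
  rewrite [X in _ + _ + X](_ : _ = K1 * N s); last first.
    by rewrite /K1 /N; field; rewrite gt_eqF.
  by rewrite /lin /a /K0; lra.
rewrite integralD//; last exact: (integrableD measurableT cst_int (lin_int a u)).
rewrite integralD//; last exact: lin_int.
rewrite lin_mean adde0 integral_probability_cst (integralZl measurableT N_int) [leRHS]EFinD.
rewrite leeD2l//.
apply: (@le_trans _ _ (K1%:E * (sigma ^+ 3)%:E)%E).
  by rewrite lee_pmul2l// lte_fin; rewrite /K1 addr_gt0 ?mulr_gt0 ?exprn_gt0.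
rewrite -EFinM lee_fin ler_wpM2r//.
  (* [sigma ^+ 3] is nonnegative because it bounds a nonnegative integral. *)
  rewrite -lee_fin; apply: le_trans Y_dev.
  by apply: integral_ge0 => s _; rewrite lee_fin exprn_ge0 ?fnorm_ge0.
have : t ^+ 6 <= t ^+ 5 by rewrite [leLHS]exprS ler_piMl// exprn_ge0// ltW.
by rewrite /K1; lra.
Qed.

End CenteredNoise.

(** * Errors along the iterates *)

Lemma powR_three_halves (R : realType) (a : R) : 0 <= a ->
  a `^ (3 / 2) = Num.sqrt a ^+ 3.
Proof.
move=> a0; rewrite -powR12_sqrt// -powR_mulrn ?powR_ge0// -powRrM.
by congr (_ `^ _); field.
Qed.

(** Stated for nonnegative functions in the extended reals, so that it applies before any moment is
    known to be finite. *)
Lemma integral_lin3 (d : measure_display) (T : measurableType d) (R : realType)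
    (mu : {measure set T -> \bar R}) (X Y W : T -> R) (a b c : R) :
  measurable_fun setT X -> measurable_fun setT Y -> measurable_fun setT W ->
  (forall w, 0 <= X w) -> (forall w, 0 <= Y w) -> (forall w, 0 <= W w) ->
  0 <= a -> 0 <= b -> 0 <= c ->
  (\int[mu]_w (a * X w + b * Y w + c * W w)%:E =
   a%:E * \int[mu]_w (X w)%:E + b%:E * \int[mu]_w (Y w)%:E
   + c%:E * \int[mu]_w (W w)%:E)%E.
Proof.
move=> mX mY mW X0 Y0 W0 a0 b0 c0.
have mE (V : T -> R) : measurable_fun setT V -> measurable_fun setT (fun w => (V w)%:E).
  by move=> mV; exact/measurable_EFinP.
have mM r (V : T -> R) : measurable_fun setT V ->
    measurable_fun setT (fun w => r%:E * (V w)%:E)%E.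
  by move=> /mE; exact: measurable_funeM.
have M0 r (V : T -> R) : 0 <= r -> (forall w, 0 <= V w) ->
    forall w, setT w -> (0 <= r%:E * (V w)%:E)%E.
  by move=> r0 V0 w _; rewrite mule_ge0// lee_fin.
under eq_integral do rewrite !EFinD !EFinM.
rewrite ge0_integralD//; last 4 first.
- by move=> w _; apply: adde_ge0; exact: M0.
- by apply: emeasurable_funD; exact: mM.
- exact: M0.
- exact: mM.
rewrite ge0_integralD//; [|exact: M0|exact: mM|exact: M0|exact: mM].
by rewrite !ge0_integralZl//; do ?[exact: mE|move=> w _; rewrite lee_fin].
Qed.

(** With z = t^2, the product (1 + 4z/9)(1 - z) is at most 1 - 5z/9, and in front of the drift it is
    bounded by 1. Here [l] stands for LF, not its root. *)
Lemma momentum_contraction (R : realFieldType) (l t U e D s : R) : 0 < l -> 0 < t -> t <= 1 ->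
  U <= (1 - t ^+ 2) * e ^+ 3 + (1 - t ^+ 2) / (t ^+ 2) ^+ 2 * D ^+ 3 ->
  0 <= D -> D <= l * s -> 0 <= e -> 0 <= s ->
  (1 + 4 / 9 * t ^+ 2) * U <= (1 - 5 / 9 * t ^+ 2) * e ^+ 3 + l ^+ 3 / t ^+ 4 * s ^+ 3.
Proof.
move=> l0 t0 t1 cc D0 hD e0 s0.
pose y := D ^+ 3 / t ^+ 4; pose z := t ^+ 2.
have yle : y <= l ^+ 3 / t ^+ 4 * s ^+ 3.
  rewrite mulrAC -exprMn ler_wpM2r ?invr_ge0 ?exprn_ge0 ?(ltW t0)//.
  by rewrite lerXn2r// nnegrE mulr_ge0// ltW.
apply: le_trans (lerD (lexx _) yle).
have y0 : 0 <= y by rewrite divr_ge0 ?exprn_ge0// ltW.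
have E0 : 0 <= e ^+ 3 by rewrite exprn_ge0.
have z0 : 0 <= z by exact: sqr_ge0.
have yE : (1 - t ^+ 2) / (t ^+ 2) ^+ 2 * D ^+ 3 = (1 - z) * y.
  by rewrite /y /z; field; rewrite gt_eqF.
rewrite yE -/z in cc; rewrite -/z.
have c0 : 0 <= 1 + 4 / 9 * z by lra.
have := ler_wpM2l c0 cc.
have zz0 := sqr_ge0 z.
have := mulr_ge0 zz0 E0; have := mulr_ge0 zz0 y0; have := mulr_ge0 z0 y0.
by clearbody y z; lra.
Qed.

Section Process.
Context (R : realType) (n : nat) (f : 'rV[R]_n -> R).
Context (dZ dXi : measure_display) (Z : measurableType dZ) (Xi : measurableType dXi).
Variables (PZ : probability Z R) (PXi : probability Xi R).
Variables (G : R -> 'rV[R]_n -> Z -> 'rV[R]_n) (H : 'rV[R]_n -> Xi -> 'M[R]_n).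
Variables (flow L LF sigma : R) (x0 : 'rV[R]_n) (eta delta theta : R).
Context (d : measure_display) (T : measurableType d) (P : probability T R).
Variables (zeta : nat -> {RV P >-> Z}) (xi : nat -> {RV P >-> Xi}).
Variable x : nat -> T -> 'rV[R]_n.
Hypothesis f_C2 : twice_continuously_differentiable f.
Hypothesis hA : assumptionA f PZ PXi G H flow L LF sigma.
Hypothesis hx : scrn_pm PZ PXi G H x0 (fun=> eta) (fun=> delta) (fun=> theta) zeta xi x.

Local Notation Fk k := (past zeta xi x k).
Local Notation TF k := (g_sigma_algebraType (Fk k)).

Let prevM k w := prev_momentum H (fun=> theta) (x ^~ w) (fun j => xi j w) k.

Lemma past_measurable k A : Fk k A -> measurable A.
Proof.
apply: smallest_sub; first exact: sigma_algebra_measurable.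
move=> B [|] [j _].
  by case=> -[C mC <-]; rewrite setTI; exact: measurable_funPTI.
by case=> C mC <-; apply: (x_measurable hx j) => //.
Qed.

(** The past is already a sigma-algebra, but its use as a measurable type generates once more. *)
Lemma past_sigma k A : <<s Fk k >> A -> Fk k A.
Proof. by apply: smallest_sub => //; exact: smallest_sigma_algebra. Qed.

Lemma past_measurable_x j k : (j <= k)%N ->
  measurable_fun setT (x j : TF k -> borel 'rV[R]_n).
Proof.
move=> jk _ B mB; do 2!apply: sub_sigma_algebra; right; exists j => //.
by exists B.
Qed.

Lemma past_measurable_xi j k : (j < k)%N ->
  measurable_fun setT (xi j : TF k -> Xi).
Proof.
move=> jk _ B mB; do 2!apply: sub_sigma_algebra; left; exists j => //.
by right; exists B.
Qed.

(** M_{j-1} involves only samples of index below j, so it belongs to the past of step j. *)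
Lemma past_measurable_momentum j k : (j <= k)%N ->
  mx_measurable (prevM j : TF k -> 'M[R]_n).
Proof.
elim: j => [_ a b|j IH jk]; first exact: measurable_cst.
apply: mx_measurableD; first by apply: mx_measurableZ; apply: IH; exact: ltnW.
apply: mx_measurableZ; apply: borel_mx_measurable.
apply: (measurableT_comp (H_measurable hA)
  (g := (fun w : TF k => (x j w, xi j w) : borel 'rV[R]_n * Xi))).
by apply: measurable_fun_pair; [by apply: past_measurable_x; exact: ltnW|exact: past_measurable_xi].
Qed.

Lemma past_indep_xi k A B : <<s Fk k >> A -> measurable B ->
  P (A `&` xi k @^-1` B) = (P A * P (xi k @^-1` B))%E.
Proof.
move=> /past_sigma FA mB; apply: (fresh_samples hx) FA _.
exists (setT `*` B); first exact: measurableX.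
by rewrite setTI; apply/seteqP; split => w //= [].
Qed.

Lemma past_indep_zeta k A B : <<s Fk k >> A -> measurable B ->
  P (A `&` zeta k @^-1` B) = (P A * P (zeta k @^-1` B))%E.
Proof.
move=> /past_sigma FA mB; apply: (fresh_samples hx) FA _.
exists (B `*` setT); first exact: measurableX.
by rewrite setTI; apply/seteqP; split => w //= [].
Qed.

Lemma past_measurable_fun k (d' : measure_display) (U : measurableType d') (h : T -> U) :
  measurable_fun setT (h : TF k -> U) -> measurable_fun setT h.
Proof.
move=> mh _ B mB; apply: (@past_measurable k); apply: past_sigma.
exact: mh measurableT B mB.
Qed.

Definition hess_error k w :=
  fnorm (momentum H (fun=> theta) (x ^~ w) (fun j => xi j w) k - hess f (x k w)).
Definition grad_error k w := fnorm (G delta (x k w) (zeta k w) - grad f (x k w)).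
Definition step_norm k w := fnorm (x k.+1 w - x k w).

Let continuous_grad : continuous (grad f).
Proof. by case: f_C2 => _ gd _ y; exact: differentiable_continuous. Qed.

Let continuous_hess : continuous (hess f).
Proof. by case: f_C2. Qed.

Let past_measurable_hess j k : (j <= k)%N ->
  mx_measurable (fun w : TF k => hess f (x j w)).
Proof.
by move=> jk; apply: continuous_mx_measurable => //; exact: past_measurable_x.
Qed.

Lemma past_measurable_hess_error k :
  measurable_fun setT (hess_error k : TF k.+1 -> R).
Proof.
apply: measurable_fnorm; apply: mx_measurableB.
  exact: past_measurable_momentum.
exact: past_measurable_hess.
Qed.

Lemma past_measurable_step_norm k :
  measurable_fun setT (step_norm k : TF k.+1 -> R).
Proof.
by apply: measurable_fnorm; apply: mx_measurableB;
  apply: borel_mx_measurable; exact: past_measurable_x.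
Qed.

Lemma measurable_grad_error k : 0 < delta < 1 -> measurable_fun setT (grad_error k).
Proof.
move=> delta01; apply: measurable_fnorm; apply: mx_measurableB.
  apply: borel_mx_measurable; apply: (measurableT_comp (G_measurable hA delta01)
    (g := (fun w => (x k w, zeta k w) : borel 'rV[R]_n * Z))).
  by apply: measurable_fun_pair => //; exact: (x_measurable hx).
by apply: continuous_mx_measurable => //; exact: (x_measurable hx).
Qed.

Lemma past_measurable_comp (g : 'rV[R]_n -> R) j k : continuous g -> (j <= k)%N ->
  measurable_fun setT (g \o x j : TF k -> R).
Proof.
move=> cg jk; apply: (measurableT_comp _ (past_measurable_x jk)).
exact: continuous_borel_measurable.
Qed.

Lemma integral_grad_error k : 0 < delta < 1 ->
  (\int[P]_w (Num.sqrt (grad_error k w) ^+ 3)%:E <= (Num.sqrt delta ^+ 3)%:E)%E.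
Proof.
move=> delta01.
pose h (p : TF k * Z) : \bar R :=
  (fnorm (G delta (x k p.1) p.2 - grad f (x k p.1)) `^ (3 / 2))%:E.
have mh : measurable_fun [set: (TF k * Z)%type] h.
  apply/measurable_EFinP; apply: (measurableT_comp (measurable_powR (3 / 2))).
  apply: measurable_fnorm; apply: mx_measurableB.
    apply: borel_mx_measurable; apply: (measurableT_comp (G_measurable hA delta01)
      (g := (fun p : (TF k * Z)%type => (x k p.1, p.2) : borel 'rV[R]_n * Z))).
    apply: measurable_fun_pair => //.
    exact: (measurableT_comp (past_measurable_x (leqnn k)) measurable_fst).
  apply: continuous_mx_measurable => //.
  exact: (measurableT_comp (past_measurable_x (leqnn k)) measurable_fst).
have h0 p : (0 <= h p)%E by rewrite lee_fin powR_ge0.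
have hE w : (Num.sqrt (grad_error k w) ^+ 3)%:E = h (w, zeta k w).
  by rewrite /h /grad_error powR_three_halves ?fnorm_ge0.
under eq_integral do rewrite hE.
rewrite (indep_integral (@past_measurable k) (measurable_funPT (zeta k)) (zeta_law hx k)
  (@past_indep_zeta k) mh h0) -[leRHS](integral_probability_cst P).
apply: ge0_le_integralT => w; first exact: integral_ge0.
rewrite -powR_three_halves; last by case/andP: delta01 => /ltW.
by have := G_error hA delta01 (x k w); rewrite unlock.
Qed.

Let sample_measurable k : measurable_fun [set: (TF k * Xi)%type]
  (fun p => H (x k p.1) p.2 : borel 'M[R]_n).
Proof.
apply: (measurableT_comp (H_measurable hA)
  (g := (fun p : (TF k * Xi)%type => (x k p.1, p.2) : borel 'rV[R]_n * Xi))).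
apply: measurable_fun_pair => //.
exact: (measurableT_comp (past_measurable_x (leqnn k)) measurable_fst).
Qed.

Let hess_measurable k : mx_measurable (fun p : (TF k * Xi)%type => hess f (x k p.1)).
Proof.
apply: continuous_mx_measurable => //.
exact: (measurableT_comp (past_measurable_x (leqnn k)) measurable_fst).
Qed.

Let sample_mx_measurable y : mx_measurable (H y).
Proof.
apply: borel_mx_measurable; apply: (measurableT_comp (H_measurable hA)
  (g := (fun s => (y, s) : borel 'rV[R]_n * Xi))).
by apply: measurable_fun_pair.
Qed.

(** The convention theta_{-1} = 1 makes M_0 a single sample, so its error is pure sampling error. *)
Lemma integral_hess_error0 : (\int[P]_w (hess_error 0 w ^+ 3)%:E <= (sigma ^+ 3)%:E)%E.
Proof.
pose h (p : TF 0 * Xi) : \bar R := (fnorm (H (x 0 p.1) p.2 - hess f (x 0 p.1)) ^+ 3)%:E.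
have mh : measurable_fun [set: (TF 0 * Xi)%type] h.
  apply/measurable_EFinP; apply: measurable_fnormX; apply: mx_measurableB => //.
  by apply: borel_mx_measurable; exact: sample_measurable.
have h0 p : (0 <= h p)%E by rewrite lee_fin exprn_ge0 ?fnorm_ge0.
have hE w : (hess_error 0 w ^+ 3)%:E = h (w, xi 0 w).
  by rewrite /h /hess_error /momentum /= subrr scale0r add0r scale1r.
under eq_integral do rewrite hE.
rewrite (indep_integral (@past_measurable 0) (measurable_funPT (xi 0)) (xi_law hx 0)
  (@past_indep_xi 0) mh h0).
rewrite -[leRHS](integral_probability_cst P).
apply: ge0_le_integralT => w; first exact: integral_ge0.
by have := H_error hA (x 0 w); rewrite unlock.
Qed.

Lemma integral_hess_errorS (t : R) k : 0 < t <= 1 -> theta = t ^+ 2 ->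
  (\int[P]_w (hess_error k.+1 w ^+ 3)%:E <=
   \int[P]_w ((1 - 5 / 9 * t ^+ 2) * hess_error k w ^+ 3
              + LF ^+ 3 / t ^+ 4 * step_norm k w ^+ 3 + 4 * t ^+ 5 * sigma ^+ 3)%:E)%E.
Proof.
move=> t01 thetaE; have /andP[t0 t1] := t01.
have t2 : 0 < t ^+ 2 <= 1 by rewrite exprn_gt0// exprn_ile1// ltW.
(* The recursion is centered at the Hessian at x^{k+1}: [u] is determined by the past of step k+1,
   and the fresh sample enters only through noise that is centered once this past is fixed. *)
pose u w := (1 - t ^+ 2) *: (momentum H (fun=> theta) (x ^~ w) (fun j => xi j w) k
  - hess f (x k.+1 w)).
pose h (p : TF k.+1 * Xi) : \bar R :=
  (fnorm (u p.1 + t ^+ 2 *: (H (x k.+1 p.1) p.2 - hess f (x k.+1 p.1))) ^+ 3)%:E.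
have mh : measurable_fun [set: (TF k.+1 * Xi)%type] h.
  apply/measurable_EFinP; apply: measurable_fnormX; apply: mx_measurableD; last first.
    apply: mx_measurableZ; apply: mx_measurableB => //.
    by apply: borel_mx_measurable; exact: sample_measurable.
  apply: mx_measurableZ; apply: mx_measurableB => //.
  move=> i j; have mM := @past_measurable_momentum k.+1 k.+1 (leqnn _) i j.
  exact: (measurableT_comp mM measurable_fst).
have h0 p : (0 <= h p)%E by rewrite lee_fin exprn_ge0 ?fnorm_ge0.
have hE w : (hess_error k.+1 w ^+ 3)%:E = h (w, xi k.+1 w).
  have MS : momentum H (fun=> theta) (x ^~ w) (fun j => xi j w) k.+1 =
    (1 - theta) *: momentum H (fun=> theta) (x ^~ w) (fun j => xi j w) k
    + theta *: H (x k.+1 w) (xi k.+1 w) by [].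
  transitivity ((fnorm (u w
    + t ^+ 2 *: (H (x k.+1 w) (xi k.+1 w) - hess f (x k.+1 w))) ^+ 3)%:E); last by [].
  rewrite /hess_error MS /u {1 3}thetaE.
  move: (momentum _ _ _ _ _) (H _ _) (hess f _) => A B C.
  by congr (fnorm _ ^+ 3)%:E; apply/matrixP => i j; rewrite !mxE; ring.
under eq_integral do rewrite hE.
rewrite (indep_integral (@past_measurable k.+1) (measurable_funPT (xi k.+1))
  (xi_law hx k.+1) (@past_indep_xi k.+1) mh h0).
apply: ge0_le_integralT => w; first exact: integral_ge0.
apply: (@le_trans _ _ ((1 + 4 / 9 * t ^+ 2) * fnorm (u w) ^+ 3
    + 4 * t ^+ 5 * sigma ^+ 3)%:E).
  have Hu i j : (\int[PXi]_s (H (x k.+1 w) s i j)%:E = (hess f (x k.+1 w) i j)%:E)%E.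
    by have := H_unbiased hA (x k.+1 w) i j; rewrite unlock.
  have Hd : (\int[PXi]_s (fnorm (H (x k.+1 w) s - hess f (x k.+1 w)) ^+ 3)%:E <=
      (sigma ^+ 3)%:E)%E.
    by have := H_error hA (x k.+1 w); rewrite unlock.
  exact: (noise_cube_le (sample_mx_measurable (x k.+1 w)) Hu Hd (u w) t01).
rewrite lee_fin lerD2r.
pose D := fnorm (hess f (x k w) - hess f (x k.+1 w)).
have uE : u w = (1 - t ^+ 2) *: ((momentum H (fun=> theta) (x ^~ w) (fun j => xi j w) k
    - hess f (x k w)) + (hess f (x k w) - hess f (x k.+1 w))).
  by rewrite addrA subrK.
have cc : fnorm (u w) ^+ 3 <= (1 - t ^+ 2) * hess_error k w ^+ 3
    + (1 - t ^+ 2) / (t ^+ 2) ^+ 2 * D ^+ 3.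
  by rewrite uE; exact: fnorm_convex_cube.
have D0 : 0 <= D by exact: fnorm_ge0.
have hD : D <= LF * step_norm k w.
  by rewrite /D fnormB; exact: (hess_lipschitz_F hA).
have e0 : 0 <= hess_error k w by exact: fnorm_ge0.
have s0 : 0 <= step_norm k w by exact: fnorm_ge0.
exact: (momentum_contraction (LF_gt0 hA) t0 t1 cc D0 hD e0 s0).
Qed.

End Process.

(** * Lyapunov function *)

Section Potential.
Variables (R : realFieldType) (a e s : nat -> R) (K : nat) (q l t sigma : R).
Hypothesis q0 : 0 < q.
Hypothesis l0 : 0 < l.
Hypothesis t0 : 0 < t.
Hypothesis t1 : t <= 1.
Hypothesis sigma0 : 0 < sigma.
Hypothesis tE : t ^+ 2 = 7 * l ^+ 2 / (3 * q ^+ 2).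
Hypothesis KE : K%:R = q ^+ 7.
Hypothesis a_ge0 : forall k, 0 <= a k.
Hypothesis e_ge0 : forall k, 0 <= e k.
Hypothesis s_ge0 : forall k, 0 <= s k.
Hypothesis e0_le : e 0 <= sigma ^+ 3.
Hypothesis descent : forall k,
  a k.+1 + 3 / 4 * q ^+ 2 * s k <= a k + 4 / (81 * q ^+ 7) + e k / (24 * q ^+ 4).
Hypothesis contraction : forall k,
  e k.+1 <= (1 - 5 / 9 * t ^+ 2) * e k + (l ^+ 2) ^+ 3 / t ^+ 4 * s k
            + 4 * t ^+ 5 * sigma ^+ 3.

(** The contraction must repay the descent: p (5/9) theta = (7/135) / q^4 exceeds 1 / (24 q^4) by
    more than 1 / (100 q^4), and p LF^3 / theta^2 = (9/1225) q^2 is less than (3/4 - 37/50) q^2. *)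
Let p := (25 * l ^+ 2 * q ^+ 2)^-1.
Let c := (4 / 81 + 4 / 3 * l ^+ 3 * sigma ^+ 3) / q ^+ 7.

(** 75/49 is just above the square root of 7/3, chosen so that the noise coefficient 196/225 becomes
    4/3. *)
Let t_le : t <= 75 / 49 * (l / q).
Proof.
rewrite -ler_sqr ?nnegrE ?mulr_ge0 ?invr_ge0 ?(ltW l0) ?(ltW q0) ?(ltW t0)//.
rewrite tE (_ : 7 * l ^+ 2 / (3 * q ^+ 2) = 7 / 3 * (l / q) ^+ 2); last first.
  by field; rewrite gt_eqF.
by rewrite [leRHS]exprMn ler_wpM2r ?sqr_ge0//; lra.
Qed.

Let potential_step k :
  (a k.+1 + p * e k.+1) + (37 / 50 * q ^+ 2 * s k + e k / (100 * q ^+ 4))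
  <= (a k + p * e k) + c.
Proof.
have p0 : 0 <= p by rewrite ltW// invr_gt0 !mulr_gt0.
have noise : p * (4 * t ^+ 5 * sigma ^+ 3) <= 4 / 3 * l ^+ 3 * sigma ^+ 3 / q ^+ 7.
  have -> : p * (4 * t ^+ 5 * sigma ^+ 3) =
      196 / 225 * (l ^+ 2 * sigma ^+ 3 / q ^+ 6) * t.
    rewrite (_ : t ^+ 5 = (t ^+ 2) ^+ 2 * t); last by ring.
    by rewrite tE /p; field; rewrite !gt_eqF.
  have h : 0 <= 196 / 225 * (l ^+ 2 * sigma ^+ 3 / q ^+ 6).
    by rewrite mulr_ge0 ?divr_ge0 ?mulr_ge0 ?exprn_ge0 ?ltW.
  apply: le_trans (ler_wpM2l h t_le) _.
  rewrite le_eqVlt; apply/orP; left; apply/eqP.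
  by field; rewrite gt_eqF.
have := ler_wpM2l p0 (contraction k).
have -> : p * ((1 - 5 / 9 * t ^+ 2) * e k + (l ^+ 2) ^+ 3 / t ^+ 4 * s k
    + 4 * t ^+ 5 * sigma ^+ 3) =
    p * e k - 7 / 135 * (e k / q ^+ 4) + 9 / 1225 * (q ^+ 2 * s k)
    + p * (4 * t ^+ 5 * sigma ^+ 3).
  rewrite (_ : t ^+ 4 = (t ^+ 2) ^+ 2); last by ring.
  by rewrite tE /p; field; rewrite !gt_eqF.
have ek : 0 <= e k / q ^+ 4 by rewrite divr_ge0// exprn_ge0// ltW.
have sk : 0 <= q ^+ 2 * s k by rewrite mulr_ge0// sqr_ge0.
have := descent k.
have -> : e k / (24 * q ^+ 4) = 24^-1 * (e k / q ^+ 4) by field; rewrite gt_eqF.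
have -> : e k / (100 * q ^+ 4) = 100^-1 * (e k / q ^+ 4) by field; rewrite gt_eqF.
have -> : 4 / (81 * q ^+ 7) = 4 / 81 / q ^+ 7 by field; rewrite gt_eqF.
move: noise ek sk; rewrite /c mulrDl; clearbody p; lra.
Qed.

Lemma potential_sum :
  \sum_(k < K) (37 / 50 * q ^+ 2 * s k + e k / (100 * q ^+ 4)) <=
  4 / 3 * (a 0 + sigma ^+ 3 / (l ^+ 2) ^+ 2 + l ^+ 3 * sigma ^+ 3 + 1).
Proof.
have tele N : \sum_(k < N) (37 / 50 * q ^+ 2 * s k + e k / (100 * q ^+ 4))
    + (a N + p * e N) <= a 0 + p * e 0 + N%:R * c.
  elim: N => [|N IH]; first by rewrite big_ord0 mul0r add0r addr0.
  rewrite big_ord_recr /=.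
  have -> : N.+1%:R * c = N%:R * c + c by rewrite -natr1 mulrDl mul1r.
  by have := potential_step N; clearbody p c; lra.
have := tele K; rewrite KE.
have -> : q ^+ 7 * c = 4 / 81 + 4 / 3 * l ^+ 3 * sigma ^+ 3.
  by rewrite /c; field; rewrite gt_eqF.
have p0 : 0 <= p by rewrite ltW// invr_gt0 !mulr_gt0.
have pe : 0 <= p * e K by rewrite mulr_ge0.
have pe0 : p * e 0 <= sigma ^+ 3 / (l ^+ 2) ^+ 2.
  apply: le_trans (ler_wpM2l p0 e0_le) _; rewrite mulrC ler_wpM2l ?exprn_ge0 ?(ltW sigma0)//.
  (* The condition theta <= 1, read as a lower bound on [q]; it gives p <= LF^(-2). *)
  have q2 : 7 / 3 * l ^+ 2 <= q ^+ 2.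
    have : t ^+ 2 <= 1 by rewrite exprn_ile1// ltW.
    rewrite tE ler_pdivrMr ?mulr_gt0 ?exprn_gt0//; lra.
  rewrite /p lef_pV2 ?posrE ?mulr_gt0 ?exprn_gt0//.
  have l2 : 0 <= l ^+ 2 by exact: sqr_ge0.
  have := ler_wpM2l l2 q2; have := sqr_ge0 (l ^+ 2); lra.
have aK := a_ge0 K; have a00 := a_ge0 0.
have ls : 0 <= l ^+ 3 * sigma ^+ 3 by rewrite mulr_ge0 ?exprn_ge0 ?ltW.
have sl : 0 <= sigma ^+ 3 / (l ^+ 2) ^+ 2 by rewrite divr_ge0 ?exprn_ge0 ?ltW.
lra.
Qed.

End Potential.

(** * Evaluation at the random index *)

Section RandomIndex.
Context (d : measure_display) (T : measurableType d) (R : realType).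
Variables (P : probability T R) (F : set_system T) (K : nat) (idx : {RV P >-> nat}).
Local Notation TF := (g_sigma_algebraType F).
Hypothesis F_sub : forall A, F A -> measurable A.
Hypothesis K0 : (0 < K)%N.
Hypothesis idx_uniform : uniform_index K idx.
Hypothesis FX_indep : forall A B, <<s F >> A -> measurable B ->
  P (A `&` idx @^-1` B) = (P A * P (idx @^-1` B))%E.

Let in_range w := (1 <= idx w <= K)%N.

Let idx_measurable (B : set nat) : measurable (idx @^-1` B).
Proof. by rewrite -[_ @^-1` _]setTI; exact: (measurable_funP idx). Qed.

(** The K prescribed values already carry total mass 1. *)
Lemma uniform_index_null : P [set w | ~~ in_range w] = 0.
Proof.
pose A k := idx @^-1` [set k.+1].
have AE : \bigcup_(k < K) A k = [set w | in_range w].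
  apply/seteqP; split => w /=.
    by move=> [k /= kK idxE]; rewrite /in_range idxE.
  move=> /andP[i0 iK]; exists (idx w).-1; last by rewrite /A /= prednK.
  by rewrite /= prednK.
have PA : P [set w | in_range w] = 1%E.
  rewrite -AE bigcup_mkord measure_bigsetU//; last first.
    by apply/trivIsetP => i j _ _ ij; apply/seteqP; split => // w [hi hj];
      case: (etrans (esym (hi : idx w = i.+1)) hj) => /eqP; rewrite (negbTE ij).
    by move=> i; exact: idx_measurable.
  rewrite (eq_bigr (fun=> (K%:R^-1)%:E)); last first.
    by move=> k _; apply: idx_uniform; rewrite /= ltn_ord.
  rewrite sumEFin sumr_const card_ord -(mulr_natr K%:R^-1) mulVf// pnatr_eq0.
  by rewrite -lt0n.
have -> : [set w | ~~ in_range w] = ~` [set w | in_range w].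
  by apply/seteqP; split => w /= /negP.
rewrite probability_setC ?PA ?subee//.
exact: (idx_measurable [set i | (1 <= i <= K)%N]).
Qed.

(** The value +oo out of range is harmless on a null set and lets later pointwise comparisons hold
    everywhere. In range, the integrand is a sum of [Y k.+1] times the indicator of the index k+1,
    and independence integrates each product. *)
Lemma random_index_integral (Y : nat -> T -> R) :
  (forall k w, 0 <= Y k w) ->
  (forall k, measurable_fun setT (Y k : TF -> R)) ->
  (\int[P]_w (if (0 < idx w <= K)%N then (Y (idx w) w)%:E else +oo) =
   (K%:R^-1)%:E * \sum_(k < K) \int[P]_w (Y k.+1 w)%:E)%E.
Proof.
move=> Y0 mY.
pose y k w : \bar R := ((Y k.+1 w)%:E * (\1_[set k.+1] (idx w))%:E)%E.
have y0 k w : (0 <= y k w)%E by rewrite mule_ge0// lee_fin.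
have mYT k : measurable_fun setT (Y k).
  move=> _ B mB; apply: (@smallest_sub _ (sigma_algebra setT) F measurable _ F_sub).
    exact: sigma_algebra_measurable.
  exact: mY measurableT B mB.
have mi k : measurable_fun [set: nat] (\1_[set k.+1] : nat -> R).
  exact: measurable_indic.
have my k : measurable_fun setT (y k).
  apply: emeasurable_funM; first exact/measurable_EFinP/mYT.
  by apply/measurable_EFinP; exact: (measurableT_comp (mi k) (measurable_funPT idx)).
have yE k : (k < K)%N -> (\int[P]_w y k w = (K%:R^-1)%:E * \int[P]_w (Y k.+1 w)%:E)%E.
  move=> kK; pose h (p : TF * nat) : \bar R := ((Y k.+1 p.1)%:E * (\1_[set k.+1] p.2)%:E)%E.
  have mh : measurable_fun [set: (TF * nat)%type] h.
    apply: emeasurable_funM; apply/measurable_EFinP.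
      exact: (measurableT_comp (mY k.+1) measurable_fst).
    exact: (measurableT_comp (mi k) measurable_snd).
  have h0 p : (0 <= h p)%E by rewrite mule_ge0// lee_fin.
  have := @indep_integral _ _ _ _ _ P (distribution P idx) F idx F_sub
    (measurable_funPT idx) (fun _ _ => erefl) FX_indep h mh h0.
  move=> ->; rewrite -ge0_integralZl//; last 2 first.
  - exact/measurable_EFinP/mYT.
  - by move=> w _; rewrite lee_fin.
  apply: eq_integral => w _.
  transitivity (\int[distribution P idx]_s ((Y k.+1 w)%:E * (\1_[set k.+1] s)%:E))%E => //.
  rewrite ge0_integralZl//; last by rewrite lee_fin.
  rewrite integral_indic// setIT muleC; congr (_ * _)%E.
  by apply: idx_uniform.
pose g w := (\sum_(k < K) y k w)%E.
have g0 w : (0 <= g w)%E by rewrite sume_ge0.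
have mg : measurable_fun setT g by apply: emeasurable_sum.
pose G w := if in_range w then g w else +oo%E.
transitivity (\int[P]_w G w)%E.
  apply: eq_integral => w _; rewrite /G /in_range.
  case: ifPn => // /andP[i0 iK]; have iK' : ((idx w).-1 < K)%N by rewrite prednK.
  rewrite /g (bigD1 (Ordinal iK'))//= [X in (X + _)%E]/y prednK// indicE mem_set// mule1.
  rewrite big1 ?adde0// => i; rewrite -val_eqE /= => ni.
  rewrite /y indicE memNset ?mule0//= => idxE.
  by move: ni; rewrite idxE eqxx.
transitivity (\int[P]_w g w)%E.
  apply: ge0_ae_eq_integral => //.
  - apply: measurable_fun_ifT => //; apply: (measurable_fun_bool true).
    by rewrite setTI (_ : _ @^-1` _ = idx @^-1` [set i | (1 <= i <= K)%N]).
  - by move=> w _; rewrite /G; case: ifP => // _; rewrite leey.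
  exists [set w | ~~ in_range w]; split.
  - exact: (idx_measurable [set i | ~~ (1 <= i <= K)%N]).
  - exact: uniform_index_null.
  - by move=> w /= h; apply/negP => wr; apply: h => _; rewrite /G wr.
rewrite ge0_integral_sum// ge0_sume_distrr; last first.
  by move=> k _; apply: integral_ge0 => w _; rewrite lee_fin.
by apply: eq_bigr => k _; exact: yE.
Qed.

End RandomIndex.

(** * Expected bounds *)

Lemma ge0_fin_numD (R : realType) (X S : \bar R) (c r : R) : 0 < c ->
  (0 <= X -> 0 <= S -> X + c%:E * S <= r%:E -> X \is a fin_num /\ S \is a fin_num)%E.
Proof.
move=> c0 X0 S0 h.
have cS0 : (0 <= c%:E * S)%E by rewrite mule_ge0// lee_fin ltW.
have Xoo : (X < +oo)%E by rewrite (le_lt_trans (leeDl _ cS0))// (le_lt_trans h)// ltry.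
have Soo : (c%:E * S < +oo)%E.
  by rewrite (le_lt_trans (leeDr _ X0))// (le_lt_trans h)// ltry.
rewrite !ge0_fin_numE//; split=> //; rewrite ltey; apply: contraTneq Soo => ->.
by rewrite gt0_muley ?lte_fin.
Qed.

(* gap, eg, eh and st stand for f(x^k) - flow, the power 3/2 of the gradient
   error, and the cubes of the Hessian error and of the step length; l ^+ 2 is LF
   and t ^+ 2 is theta. *)
Section AbstractMoments.
Context (d : measure_display) (T : measurableType d) (R : realType).
Variables (P : probability T R) (gap eg eh st : nat -> T -> R).
Variables (l sigma q t g0 : R) (K : nat).
Hypothesis q_gt0 : 0 < q.
Hypothesis l_gt0 : 0 < l.
Hypothesis sigma_gt0 : 0 < sigma.
Hypothesis t01 : 0 < t <= 1.
Hypothesis KE : K%:R = q ^+ 7.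
Hypothesis tE : t ^+ 2 = 7 * l ^+ 2 / (3 * q ^+ 2).
Hypothesis mgap : forall k, measurable_fun setT (gap k).
Hypothesis meg : forall k, measurable_fun setT (eg k).
Hypothesis meh : forall k, measurable_fun setT (eh k).
Hypothesis mst : forall k, measurable_fun setT (st k).
Hypothesis gap_ge0 : forall k w, 0 <= gap k w.
Hypothesis eg_ge0 : forall k w, 0 <= eg k w.
Hypothesis eh_ge0 : forall k w, 0 <= eh k w.
Hypothesis st_ge0 : forall k w, 0 <= st k w.
Hypothesis gap0 : forall w, gap 0 w = g0.
Hypothesis int_eh0 : (\int[P]_w (eh 0 w)%:E <= (sigma ^+ 3)%:E)%E.
Hypothesis int_eg : forall k, (\int[P]_w (eg k w)%:E <= ((27 * q ^+ 6)^-1)%:E)%E.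
Hypothesis decrease : forall k w, gap k.+1 w + 3 / 4 * q ^+ 2 * st k w <=
  gap k w + 4 / (3 * q) * eg k w + (24 * q ^+ 4)^-1 * eh k w.
Hypothesis contraction : forall k, (\int[P]_w (eh k.+1 w)%:E <=
  \int[P]_w ((1 - 5 / 9 * t ^+ 2) * eh k w + (l ^+ 2) ^+ 3 / t ^+ 4 * st k w
             + 4 * t ^+ 5 * sigma ^+ 3)%:E)%E.

Let int_ge0 (X : T -> R) : (forall w, 0 <= X w) -> (0 <= \int[P]_w (X w)%:E)%E.
Proof. by move=> X0; apply: integral_ge0 => w _; rewrite lee_fin. Qed.

Let integral_decrease k :
  (\int[P]_w (gap k.+1 w)%:E + (3 / 4 * q ^+ 2)%:E * \int[P]_w (st k w)%:E <=
   \int[P]_w (gap k w)%:E + (4 / (3 * q))%:E * \int[P]_w (eg k w)%:E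
   + ((24 * q ^+ 4)^-1)%:E * \int[P]_w (eh k w)%:E)%E.
Proof.
have c1 : 0 <= 3 / 4 * q ^+ 2 by rewrite mulr_ge0// sqr_ge0.
have c2 : 0 <= 4 / (3 * q) by rewrite divr_ge0// mulr_ge0// ltW.
have c3 : 0 <= (24 * q ^+ 4)^-1 by rewrite invr_ge0 mulr_ge0// exprn_ge0// ltW.
have := integral_lin3 P (mgap k.+1) (mst k) (mst k) (gap_ge0 k.+1) (st_ge0 k) (st_ge0 k)
  ler01 c1 (lexx 0).
rewrite mul1e mul0e adde0 => <-.
have := integral_lin3 P (mgap k) (meg k) (meh k) (gap_ge0 k) (eg_ge0 k) (eh_ge0 k)
  ler01 c2 c3.
rewrite mul1e => <-.
apply: ge0_le_integralT => w; rewrite lee_fin mul1r; last first.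
  by rewrite mul0r addr0 mul1r; exact: decrease.
by rewrite mul0r addr0 addr_ge0// mulr_ge0.
Qed.

Let integral_contraction k :
  (\int[P]_w (eh k.+1 w)%:E <=
   (1 - 5 / 9 * t ^+ 2)%:E * \int[P]_w (eh k w)%:E
   + ((l ^+ 2) ^+ 3 / t ^+ 4)%:E * \int[P]_w (st k w)%:E
   + (4 * t ^+ 5 * sigma ^+ 3)%:E)%E.
Proof.
have /andP[t0 t1] := t01.
have t2 : t ^+ 2 <= 1 by rewrite exprn_ile1// ltW.
have c1 : 0 <= 1 - 5 / 9 * t ^+ 2 by lra.
have c2 : 0 <= (l ^+ 2) ^+ 3 / t ^+ 4 by rewrite divr_ge0// !exprn_ge0// ltW.
have c3 : 0 <= 4 * t ^+ 5 * sigma ^+ 3.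
  by rewrite !mulr_ge0 ?exprn_ge0// ltW.
apply: le_trans (contraction k) _.
have m1 : measurable_fun [set: T] (fun=> 1 : R) by exact: measurable_cst.
have := integral_lin3 P (meh k) (mst k) m1 (eh_ge0 k) (st_ge0 k)
  (fun=> ler01) c1 c2 c3.
rewrite integral_probability_cst mule1 => <-.
by rewrite le_eqVlt; apply/orP; left; apply/eqP; apply: eq_integral => w _; rewrite mulr1.
Qed.

Let int_eg_fin k : (\int[P]_w (eg k w)%:E)%E \is a fin_num.
Proof.
rewrite ge0_fin_numE; last exact: int_ge0.
by apply: le_lt_trans (int_eg k) _; rewrite ltry.
Qed.

(** The two recursions alternate: a finite gap and error at k give, by descent, a finite step and
    next gap; the contraction then gives a finite next error. *)
Let moments_fin k :
  [/\ (\int[P]_w (gap k w)%:E)%E \is a fin_num, (\int[P]_w (eh k w)%:E)%E \is a fin_num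
    & (\int[P]_w (st k w)%:E)%E \is a fin_num].
Proof.
have st_fin j : (\int[P]_w (gap j w)%:E)%E \is a fin_num ->
    (\int[P]_w (eh j w)%:E)%E \is a fin_num ->
    (\int[P]_w (gap j.+1 w)%:E)%E \is a fin_num /\ (\int[P]_w (st j w)%:E)%E \is a fin_num.
  move=> gj ej; have := integral_decrease j.
  rewrite -(fineK gj) -(fineK ej) -(fineK (int_eg_fin j)) -!EFinM -!EFinD.
  by apply: ge0_fin_numD; rewrite ?mulr_gt0 ?exprn_gt0//; exact: int_ge0.
have [] : (\int[P]_w (gap k w)%:E)%E \is a fin_num /\ (\int[P]_w (eh k w)%:E)%E \is a fin_num.
  elim: k => [|k [gk ek]].
    split.
      under eq_integral do rewrite gap0.
      by rewrite integral_probability_cst.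
    rewrite ge0_fin_numE; last exact: int_ge0.
    by apply: le_lt_trans int_eh0 _; rewrite ltry.
  have [gk1 sk] := st_fin k gk ek; split; first exact: gk1.
  rewrite ge0_fin_numE; last exact: int_ge0.
  apply: le_lt_trans (integral_contraction k) _.
  by rewrite -(fineK ek) -(fineK sk) -!EFinM -!EFinD ltry.
by move=> gk ek; have [_ sk] := st_fin k gk ek; split; [exact: gk|exact: ek|exact: sk].
Qed.

Let m := g0 + sigma ^+ 3 / (l ^+ 2) ^+ 2 + l ^+ 3 * sigma ^+ 3 + 1.
Let A k := fine (\int[P]_w (gap k w)%:E).
Let E k := fine (\int[P]_w (eh k w)%:E).
Let S k := fine (\int[P]_w (st k w)%:E).

Let AE k : (\int[P]_w (gap k w)%:E = (A k)%:E)%E.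
Proof. by have [h _ _] := moments_fin k; rewrite /A fineK. Qed.
Let EE k : (\int[P]_w (eh k w)%:E = (E k)%:E)%E.
Proof. by have [_ h _] := moments_fin k; rewrite /E fineK. Qed.
Let SE k : (\int[P]_w (st k w)%:E = (S k)%:E)%E.
Proof. by have [_ _ h] := moments_fin k; rewrite /S fineK. Qed.

Let A_ge0 k : 0 <= A k. Proof. by rewrite -lee_fin -AE; exact: int_ge0. Qed.
Let E_ge0 k : 0 <= E k. Proof. by rewrite -lee_fin -EE; exact: int_ge0. Qed.
Let S_ge0 k : 0 <= S k. Proof. by rewrite -lee_fin -SE; exact: int_ge0. Qed.

Let moment_sum :
  \sum_(k < K) (37 / 50 * q ^+ 2 * S k + E k / (100 * q ^+ 4)) <= 4 / 3 * m.
Proof.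
have /andP[t0 t1] := t01.
have A0 : A 0 = g0.
  apply: EFin_inj; rewrite -AE; under eq_integral do rewrite gap0.
  exact: integral_probability_cst.
rewrite /m -A0; apply: (potential_sum (t := t)) => //.
- by rewrite -lee_fin -EE; exact: int_eh0.
- move=> k; rewrite -lee_fin !EFinD.
  have := integral_decrease k; rewrite !AE SE EE -!EFinM => /le_trans; apply.
  rewrite -addeA -[leRHS]addeA leeD2l// (mulrC _^-1) leeD2r//.
  have c0 : 0 <= 4 / (3 * q) by rewrite divr_ge0// mulr_ge0// ltW.
  have := lee_wpmul2l (_ : 0 <= (4 / (3 * q))%:E)%E (int_eg k).
  move=> /(_ _)/le_trans; apply; first by rewrite lee_fin.
  rewrite -EFinM lee_fin le_eqVlt; apply/orP; left; apply/eqP.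
  by field; rewrite gt_eqF.
- move=> k; rewrite -lee_fin; have h := integral_contraction k.
  by rewrite !EE SE -!EFinM -!EFinD in h; exact: h.
Qed.

(** The summand of [moment_sum] times 100 q dominates, with equality in the coefficient of [E k].
    The extra 2/27 of the gradient estimator fits into 162 = 3 * 54 because m >= 1. *)
Lemma mean_grad_le : ((K%:R^-1)%:E *
    \sum_(k < K) \int[P]_w (32 * q ^+ 3 * st k w + 2 * eg k w + (q ^+ 3)^-1 * eh k w)%:E <=
  (162 * m / q ^+ 6)%:E)%E.
Proof.
pose u k := 32 * q ^+ 3 * S k + 2 / (27 * q ^+ 6) + E k / q ^+ 3.
have uP k : (\int[P]_w (32 * q ^+ 3 * st k w + 2 * eg k w + (q ^+ 3)^-1 * eh k w)%:E
    <= (u k)%:E)%E.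
  have c1 : 0 <= 32 * q ^+ 3 by rewrite mulr_ge0// exprn_ge0// ltW.
  have c3 : 0 <= (q ^+ 3)^-1 by rewrite invr_ge0 exprn_ge0// ltW.
  rewrite integral_lin3// SE EE -!EFinM /u !EFinD (mulrC _^-1) leeD2r// leeD2l//.
  apply: (@le_trans _ _ (2%:E * ((27 * q ^+ 6)^-1)%:E)%E).
    by rewrite lee_wpmul2l// ?int_eg// lee_fin.
  by rewrite -EFinM.
apply: (@le_trans _ _ ((K%:R^-1)%:E * \sum_(k < K) (u k)%:E)%E).
  by rewrite lee_wpmul2l ?lee_fin ?invr_ge0//; apply: lee_sum => k _.
rewrite sumEFin -EFinM lee_fin KE.
have : \sum_(k < K) u k <= 100 * q * (\sum_(k < K) (37 / 50 * q ^+ 2 * S k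
    + E k / (100 * q ^+ 4))) + 2 / (27 * q ^+ 6) * q ^+ 7.
  have -> : 2 / (27 * q ^+ 6) * q ^+ 7 = \sum_(k < K) (2 / (27 * q ^+ 6)).
    by rewrite sumr_const card_ord -KE mulr_natr.
  rewrite mulr_sumr -big_split /=.
  apply: ler_sum => k _; rewrite /u mulrDr.
  have -> : 100 * q * (E k / (100 * q ^+ 4)) = E k / q ^+ 3 by field; rewrite gt_eqF.
  have : 0 <= q ^+ 3 * S k by rewrite mulr_ge0// exprn_ge0// ltW.
  lra.
have q6 : 0 < q ^+ 6 by rewrite exprn_gt0.
have q7 : 0 < q ^+ 7 by rewrite exprn_gt0.
have q100 : 0 <= 100 * q by rewrite mulr_ge0// ltW.
move=> /le_trans/(_ (lerD (ler_wpM2l q100 moment_sum) (lexx _))).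
have -> : 100 * q * (4 / 3 * m) + 2 / (27 * q ^+ 6) * q ^+ 7 = q * (400 / 3 * m + 2 / 27).
  by field; rewrite gt_eqF.
move=> h; have q7i : 0 <= (q ^+ 7)^-1 by rewrite invr_ge0 ltW.
apply: le_trans (ler_wpM2l q7i h) _.
have -> : (q ^+ 7)^-1 * (q * (400 / 3 * m + 2 / 27)) = (400 / 3 * m + 2 / 27) / q ^+ 6.
  by field; rewrite gt_eqF.
rewrite ler_wpM2r ?invr_ge0 ?(ltW q6)//.
have m1 : 1 <= m.
  rewrite /m lerDr !addr_ge0//.
  - by have := A_ge0 0; rewrite -lee_fin -AE; under eq_integral do rewrite gap0;
      rewrite integral_probability_cst lee_fin.
    by apply: divr_ge0; [exact/ltW/exprn_gt0|exact: sqr_ge0].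
  by rewrite mulr_ge0 ?exprn_ge0 ?(ltW sigma_gt0) ?(ltW l_gt0).
lra.
Qed.

(** The multiplier 4374 q^4 comes from (4/3) * 4374 = 5832 = 108 * 54, and (37/50) * 4374 exceeds
    2916. *)
Lemma mean_curvature_le : ((K%:R^-1)%:E *
    \sum_(k < K) \int[P]_w (4 * eh k w + 2916 * q ^+ 6 * st k w)%:E <=
  (5832 * m / q ^+ 3)%:E)%E.
Proof.
pose u k := 4 * E k + 2916 * q ^+ 6 * S k.
have uP k : (\int[P]_w (4 * eh k w + 2916 * q ^+ 6 * st k w)%:E = (u k)%:E)%E.
  have c1 : 0 <= 2916 * q ^+ 6.
    by apply: mulr_ge0; [exact: ler0n|apply: exprn_ge0; exact: ltW].
  have := integral_lin3 P (meh k) (mst k) (mst k) (eh_ge0 k) (st_ge0 k) (st_ge0 k)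
    (ler0n _ 4) c1 (lexx 0).
  rewrite mul0e adde0 EE SE -!EFinM -EFinD => <-.
  by apply: eq_integral => w _; rewrite mul0r addr0.
under eq_bigr do rewrite uP.
rewrite sumEFin -EFinM lee_fin KE.
have : \sum_(k < K) u k <= 4374 * q ^+ 4 * (\sum_(k < K) (37 / 50 * q ^+ 2 * S k
    + E k / (100 * q ^+ 4))).
  rewrite mulr_sumr.
  apply: ler_sum => k _; rewrite /u mulrDr.
  have -> : 4374 * q ^+ 4 * (E k / (100 * q ^+ 4)) = 4374 / 100 * E k.
    by field; rewrite gt_eqF.
  have : 0 <= q ^+ 6 * S k by rewrite mulr_ge0// exprn_ge0// ltW.
  have := E_ge0 k; lra.
have q4 : 0 <= 4374 * q ^+ 4.
  by apply: mulr_ge0; [exact: ler0n|apply: exprn_ge0; exact: ltW].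
move=> /le_trans/(_ (ler_wpM2l q4 moment_sum)) h.
rewrite mulrC ler_pdivrMr ?exprn_gt0//; apply: le_trans h _.
by rewrite le_eqVlt; apply/orP; left; apply/eqP; field; rewrite gt_eqF.
Qed.

End AbstractMoments.

Section Moments.
Context (R : realType) (n : nat) (f : 'rV[R]_n -> R).
Context (dZ dXi : measure_display) (Z : measurableType dZ) (Xi : measurableType dXi).
Variables (PZ : probability Z R) (PXi : probability Xi R).
Variables (G : R -> 'rV[R]_n -> Z -> 'rV[R]_n) (H : 'rV[R]_n -> Xi -> 'M[R]_n).
Variables (flow L l sigma q t : R) (x0 : 'rV[R]_n).
Context (d : measure_display) (T : measurableType d) (P : probability T R).
Variables (zeta : nat -> {RV P >-> Z}) (xi : nat -> {RV P >-> Xi}).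
Variable x : nat -> T -> 'rV[R]_n.
Hypothesis f_C2 : twice_continuously_differentiable f.
Hypothesis hA : assumptionA f PZ PXi G H flow L (l ^+ 2) sigma.
Local Notation eta := ((9 * q ^+ 2)^-1).
Local Notation delta := ((9 * q ^+ 4)^-1).
Hypothesis hx : scrn_pm PZ PXi G H x0 (fun=> eta) (fun=> delta) (fun=> t ^+ 2) zeta xi x.
Hypothesis q_ge1 : 1 <= q.
Hypothesis l_gt0 : 0 < l.
Hypothesis t01 : 0 < t <= 1.
Hypothesis L_le : L <= 9 / 2 * q ^+ 2.

Let eg k w := Num.sqrt (grad_error f G delta zeta x k w) ^+ 3.
Let eh k w := hess_error f H (t ^+ 2) xi x k w ^+ 3.
Let st k w := step_norm x k w ^+ 3.
Let gap k w := f (x k w) - flow.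

Let q_gt0 : 0 < q. Proof. exact: lt_le_trans q_ge1. Qed.

Let delta01 : 0 < delta < 1.
Proof.
have q4 : 1 <= q ^+ 4 by rewrite exprn_ege1.
have h : 0 < 9 * q ^+ 4 by rewrite mulr_gt0// exprn_gt0.
rewrite invr_gt0 h /= invf_lt1//; lra.
Qed.

Let eg_ge0 k w : 0 <= eg k w. Proof. by rewrite exprn_ge0// sqrtr_ge0. Qed.
Let eh_ge0 k w : 0 <= eh k w. Proof. by rewrite exprn_ge0// fnorm_ge0. Qed.
Let st_ge0 k w : 0 <= st k w. Proof. by rewrite exprn_ge0// fnorm_ge0. Qed.
Let gap_ge0 k w : 0 <= gap k w.
Proof. by rewrite subr_ge0; exact: (f_lower_bound hA). Qed.

Let meg k : measurable_fun setT (eg k).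
Proof.
apply: measurable_funX; apply: measurableT_comp.
  by apply: continuous_measurable_fun; exact: sqrt_continuous.
exact: (measurable_grad_error f_C2 hA hx).
Qed.

Let meh k : measurable_fun setT (eh k).
Proof.
apply: measurable_funX; apply: (past_measurable_fun hx (k := k.+1)).
exact: (past_measurable_hess_error _ f_C2 hA).
Qed.

Let mst k : measurable_fun setT (st k).
Proof.
apply: measurable_funX; apply: (past_measurable_fun hx (k := k.+1)).
exact: past_measurable_step_norm.
Qed.

Let f_continuous : continuous f.
Proof. by case: f_C2 => fd _ _ y; exact: differentiable_continuous. Qed.

Let mgap k : measurable_fun setT (gap k).
Proof.
apply: measurable_funB; last exact: measurable_cst.
apply: (past_measurable_fun hx (k := k)).
exact: (past_measurable_comp f_continuous (leqnn k)).
Qed.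

Let L_ge0 : 0 <= L. Proof. exact/ltW/(L_gt0 hA). Qed.

Let iter_min k w : let g := G delta (x k w) (zeta k w) in
  let M := momentum H (fun=> t ^+ 2) (x ^~ w) (fun j => xi j w) k in
  forall v, cubic_model g M eta (x k.+1 w - x k w) <= cubic_model g M eta v.
Proof.
move=> g M v; have := x_step hx k w (x k w + v).
by rewrite [in X in _ <= X](addrC (x k w)) addrK.
Qed.

Let iterE k w : x k.+1 w = x k w + (x k.+1 w - x k w).
Proof. by rewrite addrC subrK. Qed.

Lemma iterate_decrease k w : gap k.+1 w + 3 / 4 * q ^+ 2 * st k w <=
  gap k w + 4 / (3 * q) * eg k w + (24 * q ^+ 4)^-1 * eh k w.
Proof.
have := cubic_step_decrease f_C2 (hess_lipschitz hA) q_gt0 L_le (x k w) (@iter_min k w).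
rewrite -iterE -/(st k w) -/(eg k w) -/(eh k w) /gap (mulrC _^-1).
by move: (f (x k.+1 w)) (f (x k w)) => a b; lra.
Qed.

Lemma iterate_grad k w : fnorm (grad f (x k.+1 w)) `^ (3 / 2) <=
  32 * q ^+ 3 * st k w + 2 * eg k w + (q ^+ 3)^-1 * eh k w.
Proof.
have := cubic_step_grad_cube f_C2 (hess_lipschitz hA) L_ge0 q_gt0 L_le
  (x k w) (@iter_min k w).
by rewrite -iterE powR_three_halves ?fnorm_ge0// (mulrC _^-1).
Qed.

Lemma iterate_curvature k w :
  - (4 * eh k w + 2916 * q ^+ 6 * st k w) <= lambda_min (hess f (x k.+1 w)) ^+ 3.
Proof.
have := cubic_step_curvature (hess_lipschitz hA) q_gt0 L_le
  (x k w) (@iter_min k w).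
rewrite -iterE -/(st k w) -/(eh k w); move: (lambda_min _) => a; lra.
Qed.

Let int_eg k : (\int[P]_w (eg k w)%:E <= ((27 * q ^+ 6)^-1)%:E)%E.
Proof.
apply: le_trans (integral_grad_error f_C2 hA hx k delta01) _.
rewrite lee_fin (_ : Num.sqrt delta = (3 * q ^+ 2)^-1).
  by rewrite le_eqVlt; apply/orP; left; apply/eqP; field; rewrite gt_eqF.
have h : 0 < 3 * q ^+ 2 by rewrite mulr_gt0// exprn_gt0.
rewrite (_ : delta = ((3 * q ^+ 2)^-1) ^+ 2); last by field; rewrite gt_eqF.
by rewrite sqrtr_sqr ger0_norm// invr_ge0 ltW.
Qed.


Variables (K : nat) (idx : {RV P >-> nat}).
Hypothesis K_gt0 : (0 < K)%N.
Hypothesis KE : K%:R = q ^+ 7.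
Hypothesis tE : t ^+ 2 = 7 * l ^+ 2 / (3 * q ^+ 2).
Hypothesis idx_uniform : uniform_index K idx.
Hypothesis idx_indep : independent P (algorithm_randomness zeta xi x) (sigma_of idx).

Let m := f x0 - flow + sigma ^+ 3 / (l ^+ 2) ^+ 2 + l ^+ 3 * sigma ^+ 3 + 1.
Let F := algorithm_randomness zeta xi x.

Let F_sub A : F A -> measurable A.
Proof.
apply: smallest_sub; first exact: sigma_algebra_measurable.
by move=> B [k _]; exact: (past_measurable hx).
Qed.

Let F_sigma A : <<s F >> A -> F A.
Proof. by apply: smallest_sub => //; exact: smallest_sigma_algebra. Qed.

Let past_F k : past zeta xi x k `<=` <<s F >>.
Proof. by move=> A pA; do 2!apply: sub_sigma_algebra; exists k. Qed.

Let F_indep A B : <<s F >> A -> measurable B ->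
  P (A `&` idx @^-1` B) = (P A * P (idx @^-1` B))%E.
Proof.
move=> /F_sigma FA mB; apply: idx_indep FA _.
by exists B => //; rewrite setTI.
Qed.

Let gap0 w : gap 0 w = f x0 - flow.
Proof. by rewrite /gap (x_init hx). Qed.

Lemma mean_grad : ('E_P[(fun w => fnorm (grad f (x (idx w) w)) `^ (3 / 2))%R]
  <= (162 * m / q ^+ 6)%:E)%E.
Proof.
pose Y k w := fnorm (grad f (x k w)) `^ (3 / 2).
have Y0 k w : 0 <= Y k w by exact: powR_ge0.
have mY k : measurable_fun setT (Y k : g_sigma_algebraType F -> R).
  apply: (g_sigma_algebra_mfun (@past_F k)).
  apply: (measurableT_comp (measurable_powR (3 / 2))).
  apply: measurable_fnorm; apply: continuous_mx_measurable.
    by case: f_C2 => _ gd _ y; exact: differentiable_continuous.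
  exact: past_measurable_x.
rewrite unlock.
apply: (@le_trans _ _ (\int[P]_w (if (0 < idx w <= K)%N then (Y (idx w) w)%:E else +oo))%E).
  apply: ge0_le_integralT => w; first by rewrite lee_fin powR_ge0.
  by case: ifP => // _; rewrite leey.
rewrite (random_index_integral F_sub K_gt0 idx_uniform F_indep Y0 mY).
apply: le_trans (mean_grad_le q_gt0 l_gt0 (sigma_gt0 hA) t01 KE tE mgap meg meh mst gap_ge0
  eg_ge0 eh_ge0 st_ge0 gap0 (integral_hess_error0 f_C2 hA hx) int_eg iterate_decrease
  (fun k => integral_hess_errorS f_C2 hA hx k t01 erefl)).
apply: lee_wpmul2l; first by rewrite lee_fin invr_ge0.
apply: lee_sum => k _; apply: ge0_le_integralT => w; rewrite lee_fin//.
exact: iterate_grad.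
Qed.

Lemma mean_curvature : ((- (5832 * m / q ^+ 3))%:E <=
  'E_P[(fun w => lambda_min (hess f (x (idx w) w)) ^+ 3)%R])%E.
Proof.
(* The bound at x^k comes from the step k - 1 that produced it; the value at k = 0 is a dummy, as
   indices in range are positive. *)
pose Y k w := 4 * eh k.-1 w + 2916 * q ^+ 6 * st k.-1 w.
have c6 : 0 <= 2916 * q ^+ 6.
  by apply: mulr_ge0; [exact: ler0n|apply: exprn_ge0; exact: ltW].
have Y0 k w : 0 <= Y k w.
  by apply: addr_ge0; apply: mulr_ge0.
have mY k : measurable_fun setT (Y k : g_sigma_algebraType F -> R).
  apply: (g_sigma_algebra_mfun (@past_F k.-1.+1)).
  apply: measurable_funD; apply: measurable_funM; [exact: measurable_cst| |exact: measurable_cst|].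
    apply: measurable_funX; exact: (past_measurable_hess_error _ f_C2 hA).
  by apply: measurable_funX; exact: past_measurable_step_norm.
pose g w : \bar R := if (0 < idx w <= K)%N then (Y (idx w) w)%:E else +oo%E.
apply: (@le_trans _ _ (- (\int[P]_w g w))%E); last first.
  apply: expectation_geN => w.
    by rewrite /g; case: ifP => _; rewrite ?leey// lee_fin.
  rewrite /g; case: ifP => [/andP[i0 _]|_]; last by rewrite leey.
  rewrite -EFinN lee_fin lerNl /Y.
  by have := iterate_curvature (idx w).-1 w; rewrite prednK.
rewrite EFinN leeN2 (random_index_integral F_sub K_gt0 idx_uniform F_indep Y0 mY).
exact: (mean_curvature_le q_gt0 l_gt0 (sigma_gt0 hA) t01 KE tE mgap meg meh mst gap_ge0
  eg_ge0 eh_ge0 st_ge0 gap0 (integral_hess_error0 f_C2 hA hx) int_eg iterate_decrease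
  (fun k => integral_hess_errorS f_C2 hA hx k t01 erefl)).
Qed.

End Moments.

(** * From the seventh root of K to the thresholds *)

Lemma powR_le_inv (R : realType) (a b r : R) : 0 <= a -> 0 < r ->
  a `^ r <= b -> a <= b `^ r^-1.
Proof.
move=> a0 r0 h; have -> : a = (a `^ r) `^ r^-1 by rewrite -powRrM divff ?gt_eqF// powRr1.
by apply: ge0_ler_powR; rewrite ?invr_ge0 ?(ltW r0) ?nnegrE ?powR_ge0 ?(le_trans _ h) ?powR_ge0.
Qed.

Section Thresholds.
Variables (R : realType) (K : nat).
Hypothesis K_gt0 : (0 < K)%N.
Let q : R := K%:R `^ (1 / 7).

Lemma root7_gt0 : 0 < q. Proof. by apply: powR_gt0; rewrite ltr0n. Qed.

Lemma root7_powR k : K%:R `^ (k%:R / 7) = q ^+ k.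
Proof.
by rewrite -powR_mulrn ?powR_ge0// /q -powRrM; congr (_ `^ _); field.
Qed.

Lemma root7_exp7 : K%:R = q ^+ 7.
Proof. by rewrite -root7_powR divff ?powRr1// pnatr_eq0. Qed.

Lemma root7_ge1 : 1 <= q.
Proof.
have := @ge0_ler_powR R (1 / 7) _ 1 K%:R.
by rewrite !nnegrE powR1 ler1n K_gt0 ler01 ler0n => ->.
Qed.

Lemma powR_7_2_le (a : R) : 0 <= a -> a `^ (7 / 2) <= K%:R -> a <= q ^+ 2.
Proof.
move=> a0 /powR_le_inv; rewrite (_ : (7 / 2)^-1 = 2 / 7) ?root7_powR; last by field.
by apply.
Qed.

(** Taking the power 4/7 turns the hypothesis into M^(2/3) <= q^4 epsg, whose power 3/2 is the
    claim. *)
Lemma grad_threshold (M epsg : R) : 0 <= M -> 0 < epsg ->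
  (M `^ (2 / 3) / epsg) `^ (7 / 4) <= K%:R -> M / q ^+ 6 <= epsg `^ (3 / 2).
Proof.
have q0 := root7_gt0; move=> M0 eps0 /powR_le_inv.
rewrite (_ : (7 / 4)^-1 = 4 / 7) ?root7_powR; last by field.
have c0 : 0 < 7 / 4 :> R by rewrite divr_gt0.
move=> /(_ (divr_ge0 (powR_ge0 _ _) (ltW eps0)) c0); rewrite ler_pdivrMr// => h.
rewrite ler_pdivrMr ?exprn_gt0//.
have e0 : 0 <= 3 / 2 :> R by rewrite divr_ge0.
have := @ge0_ler_powR R (3 / 2) e0 (M `^ (2 / 3)) (q ^+ 4 * epsg).
rewrite !nnegrE powR_ge0 mulr_ge0 ?exprn_ge0 ?(ltW q0) ?(ltW eps0)//.
move=> /(_ isT isT h).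
rewrite -powRrM (_ : 2 / 3 * (3 / 2) = 1) ?powRr1//; last by field.
rewrite powRM ?exprn_ge0 ?(ltW q0) ?(ltW eps0)// powR_three_halves ?exprn_ge0 ?(ltW q0)//.
rewrite (_ : q ^+ 4 = (q ^+ 2) ^+ 2) ?sqrtr_sqr ?ger0_norm ?sqr_ge0//; last by ring.
by rewrite -exprM mulrC => ->.
Qed.

Lemma curvature_threshold (M epsH : R) : 0 <= M -> 0 < epsH ->
  (M `^ (1 / 3) / epsH) ^+ 7 <= K%:R -> M / q ^+ 3 <= epsH ^+ 3.
Proof.
have q0 := root7_gt0; move=> M0 eps0; rewrite root7_exp7.
rewrite ler_pXn2r ?nnegrE ?divr_ge0 ?powR_ge0 ?(ltW eps0)//.
rewrite ler_pdivrMr// => h; rewrite ler_pdivrMr ?exprn_gt0// -exprMn mulrC.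
have -> : M = (M `^ (1 / 3)) ^+ 3.
  by rewrite -powR_mulrn ?powR_ge0// -powRrM mul1r mulVf ?powRr1// pnatr_eq0.
by rewrite lerXn2r ?nnegrE ?powR_ge0// mulr_ge0 ?ltW.
Qed.

End Thresholds.

Unset Implicit Arguments.

Theorem theorem1 (R : realType) (n : nat) (hn : (0 < n)%N)
  (f : 'rV[R]_n -> R)
  (f_C2 : twice_continuously_differentiable f)
  (f_has_min : exists xopt, forall x, f xopt <= f x)
  (dZ dXi : measure_display)
  (Z : measurableType dZ) (Xi : measurableType dXi)
  (PZ : probability Z R) (PXi : probability Xi R)
  (G : R -> 'rV[R]_n -> Z -> 'rV[R]_n) (H : 'rV[R]_n -> Xi -> 'M[R]_n)
  (flow L LF sigma : R)
  (hA : assumptionA f PZ PXi G H flow L LF sigma)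
  (x0 : 'rV[R]_n) (K : nat) (hK : (0 < K)%N)
  (d : measure_display) (T : measurableType d) (P : probability T R)
  (zeta : nat -> {RV P >-> Z}) (xi : nat -> {RV P >-> Xi})
  (x : nat -> T -> 'rV[R]_n)
  (hx : scrn_pm PZ PXi G H x0
          (fun=> 1 / (9 * K%:R `^ (2 / 7)))
          (fun=> 1 / (9 * K%:R `^ (4 / 7)))
          (fun=> 7 * LF / (3 * K%:R `^ (2 / 7)))
          zeta xi x)
  (idx : {RV P >-> nat})
  (idx_uniform : uniform_index K idx)
  (idx_indep : independent P (algorithm_randomness zeta xi x) (sigma_of idx))
  (epsg epsH : R) (hepsg : 0 < epsg < 1) (hepsH : 0 < epsH < 1)
  (K_large :
    Num.max (((3 * Mpm (f x0) flow LF sigma) `^ (2 / 3) / epsg) `^ (7 / 4))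
   (Num.max (((108 * Mpm (f x0) flow LF sigma) `^ (1 / 3) / epsH) ^+ 7)
   (Num.max ((2 * L / 9) `^ (7 / 2))
   (Num.max ((7 * LF / 3) `^ (7 / 2))
            1))) <= K%:R) :
  stochastic_second_order_stationary f P epsg epsH (fun w => x (idx w) w).
Proof.
pose q : R := K%:R `^ (1 / 7); pose l := Num.sqrt LF.
pose t := Num.sqrt (7 * LF / (3 * q ^+ 2)).
have q0 : 0 < q := root7_gt0 R hK.
have q2 : 0 < 3 * q ^+ 2 by rewrite mulr_gt0// exprn_gt0.
have LF0 := LF_gt0 hA; have L0 := L_gt0 hA; have sigma0 := sigma_gt0 hA.
have l0 : 0 < l by rewrite sqrtr_gt0.
have lE : l ^+ 2 = LF by rewrite sqr_sqrtr// ltW.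
have LF7 : 0 < 7 * LF by rewrite mulr_gt0.
have tE : t ^+ 2 = 7 * LF / (3 * q ^+ 2) by rewrite sqr_sqrtr// divr_ge0// ltW.
move: K_large; rewrite !ge_max => /and5P[hg hH hL hLF _].
(* The third threshold lets the cubic regularization absorb [L]; the fourth is the condition theta
   <= 1. *)
have L_le : L <= 9 / 2 * q ^+ 2.
  have : 2 * L / 9 <= q ^+ 2 by apply: powR_7_2_le hL => //; rewrite divr_ge0// mulr_ge0// ltW.
  lra.
have LF_le : 7 * LF / 3 <= q ^+ 2 by apply: powR_7_2_le hLF => //; rewrite divr_ge0// ltW.
have t01 : 0 < t <= 1.
  rewrite sqrtr_gt0 divr_gt0//= -[leRHS]sqrtr1 ler_wsqrtr// ler_pdivrMr//; lra.
have etaE : 1 / (9 * K%:R `^ (2 / 7)) = (9 * q ^+ 2)^-1 by rewrite root7_powR div1r.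
have deltaE : 1 / (9 * K%:R `^ (4 / 7)) = (9 * q ^+ 4)^-1 by rewrite root7_powR div1r.
have thetaE : 7 * LF / (3 * K%:R `^ (2 / 7)) = t ^+ 2 by rewrite root7_powR tE.
rewrite etaE deltaE thetaE in hx; rewrite -lE in hA tE.
pose m := f x0 - flow + sigma ^+ 3 / (l ^+ 2) ^+ 2 + l ^+ 3 * sigma ^+ 3 + 1.
have ME : Mpm (f x0) flow LF sigma = 54 * m.
  by rewrite /Mpm /m powR_three_halves ?(ltW LF0)// lE.
have M0 : 0 <= Mpm (f x0) flow LF sigma.
  have gap_ge0 : 0 <= f x0 - flow by rewrite subr_ge0 (f_lower_bound hA).
  have sl : 0 <= sigma ^+ 3 / (l ^+ 2) ^+ 2 by rewrite divr_ge0// ?exprn_ge0// ltW.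
  have ls : 0 <= l ^+ 3 * sigma ^+ 3 by rewrite mulr_ge0// exprn_ge0// ltW.
  by rewrite ME /m; lra.
have /andP[epsg0 _] := hepsg; have /andP[epsH0 _] := hepsH.
have KE : K%:R = q ^+ 7 := root7_exp7 R K.
split.
- apply: le_trans (mean_grad f_C2 hA hx (root7_ge1 R hK) l0 t01 L_le hK KE tE
    idx_uniform idx_indep) _.
  rewrite lee_fin; apply: le_trans (grad_threshold hK _ epsg0 hg); last exact: mulr_ge0.
  by rewrite ME -/m -/q; lra.
- apply: le_trans (mean_curvature f_C2 hA hx (root7_ge1 R hK) l0 t01 L_le hK KE tE
    idx_uniform idx_indep).
  rewrite lee_fin lerN2; apply: le_trans (curvature_threshold hK _ epsH0 hH); last exact: mulr_ge0.
  by rewrite ME -/m -/q; lra.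
Qed.
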